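(* Let $K$ be a field and let $Q$ be the quiver with vertices $1,2,3,4$ and exactly four arrows $a:1\to 2$, $b:2\to 3$, $c:3\to 4$, $d:1\to 3$. Let $R=KQ/\operatorname{rad}^2(KQ)$ be the radical square zero algebra with quiver $Q$, and denote by $S_1,\dots,S_4$ the simple right $R$-modules, $S_i$ corresponding to the vertex $i$. \begin{enumerate} \item The indecomposable right $R$-module $N$ with dimension vector $[1,0,1,0]$ satisfies that $\operatorname{Ext}^2_R(N,R)$ is a non-zero projective left $R$-module. \item The simple right $R$-module $S_3$ is $2$-reflexive but not reflexive. \end{enumerate}
   Context: Conventions on the algebra. $KQ$ is the path algebra of $Q$ over $K$ and $\operatorname{rad}(KQ)$ is its Jacobson radical, which here is the ideal generated by the arrows; so in $R$ every path of length at least $2$ is zero. Paths are multiplied from left to right, so that, with $e_i$ the primitive idempotent of vertex $i$, the indecomposable projective right module $e_iR$ has as $K$-basis the residue classes of the paths of length at most $1$ starting at $i$, and the indecomposable projective left module $Re_i$ has as $K$-basis those ending at $i$ (for example $e_2R$ has basis $e_2,b$). ''$R$-module'' means finitely generated right $R$-module unless stated otherwise. The dimension vector of a right module $M$ is $[\dim_K Me_1,\dots,\dim_K Me_4]$. The indecomposable right module with dimension vector $[1,0,1,0]$ is unique up to isomorphism. For a right $R$-module $N$, $\operatorname{Ext}^i_R(N,R)$ is a left $R$-module via the left $R$-module structure of $R$ (and symmetrically with left and right exchanged). Reflexive modules. Let $R$ be a two-sided noetherian ring. For a finitely generated (left or right) $R$-module $M$ let $M^*=\operatorname{Hom}_R(M,R)$,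 a module on the opposite side. $M$ is called reflexive if the canonical evaluation map $\operatorname{ev}_M:M\to M^{**}$, $\operatorname{ev}_M(m)(\psi)=\psi(m)$ for $m\in M$, $\psi\in M^*$, is an isomorphism. $k$-reflexive modules (Auslander and Bridger). For a projective presentation $P_1\xrightarrow{f}P_0\to M\to 0$ by finitely generated projectives, the Auslander-Bridger transpose $\operatorname{Tr}M$ is the cokernel of $\operatorname{Hom}_R(f,R):P_0^*\to P_1^*$, a module on the opposite side. Let $\Omega^k$ denote the $k$-th syzygy, and put $D_k(M)=\Omega^k\operatorname{Tr}(M)$ and $D_k^2(M)=D_k(D_k(M))$; all of these are well defined up to projective direct summands. In the category of finitely generated $R$-modules modulo morphisms factoring through projectives, $\operatorname{Tr}\Omega^k\operatorname{Tr}$ is left adjoint to $\Omega^k$, and the natural map $M\to D_k^2(M)=\Omega^k\operatorname{Tr}\Omega^k\operatorname{Tr}M$ is the unit of this adjunction. $M$ is called $k$-reflexive if this natural map induces an isomorphism of functors $\operatorname{Ext}^1_R(D_k^2(M),-)\cong\operatorname{Ext}^1_R(M,-)$ on finitely generated $R$-modules. For $k=2$ one has $D_2(M)=M^*$ and $D_2^2(M)=M^{**}$ up to projective direct summands and the natural map is represented by $\operatorname{ev}_M$; thus $M$ is $2$-reflexive if and only if $\operatorname{ev}_M:M\to M^{**}$ induces an isomorphism $\operatorname{Ext}^1_R(M^{**},X)\to\operatorname{Ext}^1_R(M,X)$ for every finitely generated $R$-module $X$. *)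

(* Defs.v *)
From HB Require Import structures.
From mathcomp Require Import all_boot all_order all_algebra.
From mathcomp Require Import boolp functions.
From mathcomp Require Import finmap monalg.

Set Implicit Arguments.
Unset Strict Implicit.
Unset Printing Implicit Defensive.

Import GRing.Theory.
Local Open Scope ring_scope.
Local Open Scope quotient_scope.

(* Conventions: a left module over a ring R is an lmodType R and a right
   module over R is an lmodType R^c, where R^c is the converse ring; for
   M : lmodType R^c, r *: m is the element m.r. *)

(* The linear map on the free module with basis T that extends g *)
Section FreeLift.
Variables (A : nzRingType) (T : choiceType) (V : lmodType A) (g : T -> V).

Definition free_lift (u : {malg A[T]}) : V := \sum_(x <- msupp u) u@_x *: g x.

Lemma free_liftEw (u : {malg A[T]}) (D : {fset T}) :
  (msupp u `<=` D)%fset -> free_lift u = \sum_(x <- D) u@_x *: g x.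
Proof.
move=> /fsubsetP uD; rewrite [RHS](big_fsetID _ (mem (msupp u))) /=.
rewrite [X in _ + X]big1_fset ?addr0; last first.
  by move=> x; rewrite !inE => /andP[_ /mcoeff_outdom ->] _; rewrite scale0r.
apply: eq_fbigl => x; rewrite !inE; case: (boolP (x \in msupp u)) => [xu|_].
  by rewrite uD.
by rewrite andbF.
Qed.

Fact free_lift_is_linear : linear free_lift.
Proof.
move=> a u v; set D := (msupp u `|` msupp v)%fset.
have uD : (msupp u `<=` D)%fset by exact: fsubsetUl.
have vD : (msupp v `<=` D)%fset by exact: fsubsetUr.
have auvD : (msupp (a *: u + v) `<=` D)%fset.
  apply: fsubset_trans (msuppD_le _ _) _.
  by rewrite fsetSU // msuppZ_le.
rewrite (free_liftEw uD) (free_liftEw vD) (free_liftEw auvD).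
rewrite scaler_sumr -big_split /=; apply: eq_bigr => x _.
by rewrite mcoeffD mcoeffZ scalerDl scalerA.
Qed.

HB.instance Definition _ :=
  GRing.isLinear.Build A {malg A[T]} V *:%R free_lift free_lift_is_linear.

Lemma free_liftU x : free_lift << x >> = g x.
Proof.
by rewrite (free_liftEw msuppU_le) big_seq_fset1 mcoeffUU scale1r.
Qed.

End FreeLift.

Lemma free_ext (A : nzRingType) (T : choiceType) (V : lmodType A)
    (f g : {malg A[T]} -> V) : linear f -> linear g ->
  (forall x, f << x >> = g << x >>) -> f =1 g.
Proof.
move=> f_lin g_lin fg.
pose F : {linear {malg A[T]} -> V} :=
  HB.pack f (GRing.isLinear.Build A {malg A[T]} V *:%R f f_lin).
pose G : {linear {malg A[T]} -> V} :=
  HB.pack g (GRing.isLinear.Build A {malg A[T]} V *:%R g g_lin).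
move=> u; change (F u = G u); rewrite [u]monalgE !raddf_sum.
apply: eq_bigr => x _.
have -> : << u@_x *g x >> = u@_x *: (<< x >> : {malg A[T]}).
  by apply/malgP => y; rewrite mcoeffZ !mcoeffU mulrnAr mulr1.
have FZ (H : {linear {malg A[T]} -> V}) a v : H (a *: v) = a *: H v.
  exact: linearZ.
apply: (etrans (FZ F _ _)); apply: (etrans _ (esym (FZ G _ _))).
by congr (_ *: _); exact: fg.
Qed.

Record quiver := Quiver {
  vertex : finType;
  arrow : finType;
  source : arrow -> vertex;
  target : arrow -> vertex;
  quiver_vertex : vertex (* quivers are nonempty, so that 1 != 0 in KQ *)
}.

Section Paths.
Variable Q : quiver.

Fixpoint is_walk (i : vertex Q) (s : seq (arrow Q)) : bool :=
  if s is x :: s' then (source x == i) && is_walk (target x) s' else true.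

Definition walk_end (i : vertex Q) (s : seq (arrow Q)) : vertex Q :=
  last i (map (@target Q) s).

(* A path is its starting vertex followed by its arrows, from left to right;
   the paths with no arrow are the trivial paths e_i. *)
Record qpath := QPath {
  qpath_val : vertex Q * seq (arrow Q);
  _ : is_walk qpath_val.1 qpath_val.2
}.

HB.instance Definition _ := [isSub for qpath_val].
HB.instance Definition _ := [Choice of qpath by <:].

Definition path_source (p : qpath) : vertex Q := (val p).1.
Definition path_arrows (p : qpath) : seq (arrow Q) := (val p).2.
Definition path_target (p : qpath) : vertex Q :=
  walk_end (path_source p) (path_arrows p).

Definition trivial_path (i : vertex Q) : qpath := @QPath (i, [::]) isT.

Fact arrow_path_subproof (x : arrow Q) : is_walk (source x) [:: x].
Proof. by rewrite /= eqxx. Qed.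
Definition arrow_path (x : arrow Q) : qpath :=
  @QPath (source x, [:: x]) (arrow_path_subproof x).

Lemma is_walk_cat i s t :
  is_walk i (s ++ t) = is_walk i s && is_walk (walk_end i s) t.
Proof. by elim: s i => //= x s IHs i; rewrite IHs andbA. Qed.

Lemma walk_end_cat i s t : walk_end i (s ++ t) = walk_end (walk_end i s) t.
Proof. by rewrite /walk_end map_cat last_cat. Qed.

Fact path_cat_subproof (p q : qpath) : path_target p = path_source q ->
  is_walk (path_source p) (path_arrows p ++ path_arrows q).
Proof. by move=> pq; rewrite is_walk_cat (valP p) -/(path_target p) pq (valP q). Qed.

Definition path_cat p q (pq : path_target p = path_source q) : qpath :=
  @QPath (path_source p, path_arrows p ++ path_arrows q) (path_cat_subproof pq).

Lemma path_cat_target p q (pq : path_target p = path_source q) :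
  path_target (path_cat pq) = path_target q.
Proof.
by rewrite {1}/path_target /= walk_end_cat -/(path_target p) pq.
Qed.

End Paths.

Section PathAlgebra.
Variables (K : fieldType) (Q : quiver).

Definition path_algebra : Type := {malg K[qpath Q]}.

HB.instance Definition _ := GRing.Lmodule.on path_algebra.

Definition path_basis (p : qpath Q) : path_algebra := << p >>.

Definition path_mul (p q : qpath Q) : path_algebra :=
  if path_target p =P path_source q is ReflectT pq
  then path_basis (path_cat pq) else 0.

Definition path_algebra_mul (u v : path_algebra) : path_algebra :=
  free_lift (fun p => free_lift (fun q => path_mul p q) v) u.

Definition path_algebra_one : path_algebra :=
  \sum_(i : vertex Q) path_basis (trivial_path i).

Local Notation "u ** v" := (path_algebra_mul u v) (at level 40).

Fact path_algebra_mul_linearl v : linear (path_algebra_mul^~ v).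
Proof. exact: free_lift_is_linear. Qed.

Fact path_algebra_mul_linearr u : linear (path_algebra_mul u).
Proof.
move=> a v w; rewrite /path_algebra_mul /free_lift scaler_sumr -big_split /=.
apply: eq_bigr => p _.
rewrite -!/(free_lift _ _) free_lift_is_linear scalerDr !scalerA.
by rewrite mulrC.
Qed.

Fact path_algebra_mulE p q : path_basis p ** path_basis q = path_mul p q.
Proof. by rewrite /path_algebra_mul !free_liftU. Qed.

HB.instance Definition _ u := GRing.isLinear.Build K path_algebra path_algebra
  *:%R (path_algebra_mul u) (path_algebra_mul_linearr u).

Fact path_algebra_mul_suml (I : finType) (F : I -> path_algebra) v :
  (\sum_i F i) ** v = \sum_i (F i ** v).
Proof.
pose g p : path_algebra := free_lift (fun q => path_mul p q) v.
exact: (raddf_sum (free_lift g)).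
Qed.

Fact path_algebra_mulA : associative path_algebra_mul.
Proof.
move=> u v w.
apply: (free_ext (f := fun u => u ** (v ** w)) (g := fun u => (u ** v) ** w))
  u => [a x y|a x y|p].
- exact: path_algebra_mul_linearl.
- by rewrite /= !path_algebra_mul_linearl.
apply: (free_ext (f := fun v => << p >> ** (v ** w))
                 (g := fun v => (<< p >> ** v) ** w)) v => [a x y|a x y|q].
- by rewrite path_algebra_mul_linearl path_algebra_mul_linearr.
- by rewrite path_algebra_mul_linearr path_algebra_mul_linearl.
apply: (free_ext (f := fun w => << p >> ** (<< q >> ** w))
                 (g := fun w => (<< p >> ** << q >>) ** w)) w => [a x y|a x y|r].
- by rewrite !path_algebra_mul_linearr.
- by rewrite !path_algebra_mul_linearr.
rewrite -!/(path_basis _) !path_algebra_mulE /path_mul.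
case: eqP => [qr|nqr]; case: eqP => [pq|npq]; rewrite ?linear0.
- rewrite !path_algebra_mulE /path_mul.
  case: eqP => [pqr|]; last by rewrite pq.
  case: eqP => [pqr'|]; last by rewrite path_cat_target qr.
  by congr path_basis; apply: val_inj; rewrite /= /path_arrows /= catA.
- rewrite path_algebra_mulE /path_mul; case: eqP => // pqr.
  by rewrite -[0 ** _]/(free_lift _ 0) linear0.
- rewrite path_algebra_mulE /path_mul; case: eqP => // pqr.
  by case: nqr; rewrite -pqr path_cat_target.
- by rewrite -[0 ** _]/(free_lift _ 0) linear0.
Qed.

Fact path_algebra_mul1 : left_id path_algebra_one path_algebra_mul.
Proof.
move=> u; apply: (free_ext (f := fun u => path_algebra_one ** u)
  (g := fun u => u)) u => [a x y||p] //.
  by rewrite path_algebra_mul_linearr.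
rewrite path_algebra_mul_suml (bigD1 (path_source p)) //=.
rewrite big1 => [|i ip]; rewrite -/(path_basis p) path_algebra_mulE /path_mul.
  case: eqP => [e|] //; rewrite addr0; congr path_basis; apply: val_inj => /=.
  by rewrite /path_source /path_arrows /=; case: (val p).
by case: eqP => // e; rewrite -e eqxx in ip.
Qed.

Fact path_algebra_mulr1 : right_id path_algebra_one path_algebra_mul.
Proof.
move=> u; apply: (free_ext (f := fun u => u ** path_algebra_one)
  (g := fun u => u)) u => [a x y||p] //.
  by rewrite path_algebra_mul_linearl.
rewrite raddf_sum (bigD1 (path_target p)) //=.
rewrite big1 => [|i ip]; rewrite -/(path_basis p) path_algebra_mulE /path_mul.
  case: eqP => [e|] //; rewrite addr0; congr path_basis; apply: val_inj => /=.
  by rewrite /path_source /path_arrows /= cats0; case: (val p).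
by case: eqP => // e; rewrite e eqxx in ip.
Qed.

Fact path_algebra_mulDl : left_distributive path_algebra_mul +%R.
Proof.
move=> u v w; have := path_algebra_mul_linearl w 1 u v.
by rewrite !scale1r.
Qed.

Fact path_algebra_mulDr : right_distributive path_algebra_mul +%R.
Proof. by move=> u v w; rewrite linearD. Qed.

Fact path_algebra_one_neq0 : path_algebra_one != 0.
Proof.
apply/eqP => /(congr1 (mcoeff (trivial_path (quiver_vertex Q)))).
rewrite mcoeff0 raddf_sum (bigD1 (quiver_vertex Q)) //= big1 => [|i ip].
  by rewrite mcoeffUU addr0 => /eqP; rewrite oner_eq0.
rewrite mcoeffU; case: eqP => // /(congr1 val) [e].
by rewrite e eqxx in ip.
Qed.

HB.instance Definition _ := GRing.Zmodule_isNzRing.Build path_algebra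
  path_algebra_mulA path_algebra_mul1 path_algebra_mulr1 path_algebra_mulDl
  path_algebra_mulDr path_algebra_one_neq0.

Fact path_algebra_scaleAl (a : K) (u v : path_algebra) :
  a *: (u * v) = (a *: u) * v.
Proof.
have := path_algebra_mul_linearl v a u 0.
by rewrite !addr0 -[0 ** _]/(free_lift _ 0) linear0 addr0 => /esym.
Qed.

HB.instance Definition _ :=
  GRing.Lmodule_isLalgebra.Build K path_algebra path_algebra_scaleAl.

Fact path_algebra_scaleAr (a : K) (u v : path_algebra) :
  a *: (u * v) = u * (a *: v).
Proof. by rewrite -[u * _]/(u ** _) -linearZ. Qed.

HB.instance Definition _ :=
  GRing.Lalgebra_isAlgebra.Build K path_algebra path_algebra_scaleAr.

End PathAlgebra.

Arguments path_basis K {Q} p.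

Section Kernel.
Variables (B : pzRingType) (V W : lmodType B) (f : {linear V -> W}).

Definition ker_pred : {pred V} := [pred v | f v == 0].

Fact ker_pred_closed : submod_closed ker_pred.
Proof.
split=> [|a u v]; first by rewrite inE linear0.
by rewrite !inE linearP => /eqP-> /eqP->; rewrite scaler0 addr0.
Qed.

HB.instance Definition _ := GRing.isSubmodClosed.Build B V ker_pred
  ker_pred_closed.

Record ker := Ker { ker_val : V; _ : ker_val \in ker_pred }.

HB.instance Definition _ := [isSub for ker_val].
HB.instance Definition _ := [Choice of ker by <:].
HB.instance Definition _ := [SubChoice_isSubLmodule of ker by <:].

Definition ker_incl : {linear ker -> V} := \val.

Lemma ker_valP (x : ker) : f (val x) = 0. Proof. by apply/eqP; case: x. Qed.

End Kernel.

(* The quotient of V by the submodule I; its projection is \pi_(quotmod I) *)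
Section QuotientModule.
Variables (B : pzRingType) (V : lmodType B) (I : submodClosed V).

Definition quotmod_pred : {pred V} := I.

Fact quotmod_pred_closed : zmod_closed quotmod_pred.
Proof.
split=> [|u v uI vI]; first exact: (rpred0 I).
by apply: (rpredD (uI : u \in I)); rewrite -scaleN1r; apply: rpredZ.
Qed.

HB.instance Definition _ := GRing.isZmodClosed.Build V quotmod_pred
  quotmod_pred_closed.

Definition quotmod : Type := Quotient.quot quotmod_pred.

HB.instance Definition _ : EqQuotient V (Quotient.equiv quotmod_pred) quotmod :=
  EqQuotient.on quotmod.
HB.instance Definition _ := GRing.Zmodule.on quotmod.

Local Notation pi := (\pi_quotmod).

Lemma quotmod_eqP (u v : V) : reflect (pi u = pi v) (u - v \in I).
Proof.
rewrite -[u - v \in I]/(u - v \in quotmod_pred) Quotient.idealrBE.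
exact: eqP.
Qed.

Lemma quotmod_piD u v : pi (u + v) = pi u + pi v.
Proof. by rewrite -[LHS]/(\pi_(Quotient.quot quotmod_pred) (u + v)) !piE. Qed.

Definition quotmod_scale (b : B) (x : quotmod) : quotmod := pi (b *: repr x).

Lemma quotmod_scaleE b v : quotmod_scale b (pi v) = pi (b *: v).
Proof.
apply/quotmod_eqP; rewrite -scalerBr rpredZ //.
by apply/quotmod_eqP; rewrite reprK.
Qed.

Fact quotmod_scaleA a b x :
  quotmod_scale a (quotmod_scale b x) = quotmod_scale (a * b) x.
Proof.
elim/quotW: x => v.
by rewrite (quotmod_scaleE b v) !quotmod_scaleE scalerA.
Qed.

Fact quotmod_scale1 : left_id 1 quotmod_scale.
Proof. by elim/quotW=> v; rewrite quotmod_scaleE scale1r. Qed.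

Fact quotmod_scaleDr : right_distributive quotmod_scale +%R.
Proof.
move=> a; elim/quotW=> u; elim/quotW=> v.
by rewrite -quotmod_piD !quotmod_scaleE scalerDr quotmod_piD.
Qed.

Fact quotmod_scaleDl x : {morph quotmod_scale^~ x : a b / a + b}.
Proof.
move=> a b; elim/quotW: x => v.
by rewrite !quotmod_scaleE scalerDl quotmod_piD.
Qed.

HB.instance Definition _ := GRing.Zmodule_isLmodule.Build B quotmod
  quotmod_scaleA quotmod_scale1 quotmod_scaleDr quotmod_scaleDl.

End QuotientModule.

(* A left B-module with a commuting action of A *)
Record bimod (A B : pzRingType) := Bimod {
  bimod_sort :> lmodType B;
  bimod_act : A -> bimod_sort -> bimod_sort;
  bimod_act1 : forall x, bimod_act 1 x = x;
  bimod_actA : forall a b x, bimod_act a (bimod_act b x) = bimod_act (a * b) x;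
  bimod_actDl : forall a b x,
    bimod_act (a + b) x = bimod_act a x + bimod_act b x;
  bimod_actDr : forall a x y,
    bimod_act a (x + y) = bimod_act a x + bimod_act a y;
  bimod_actZ : forall a b x, bimod_act a (b *: x) = b *: bimod_act a x
}.

Section Hom.
Variables (A B : pzRingType) (M : lmodType A) (X : bimod A B).

Definition hom_linear (f : M -> X) : Prop :=
  forall a m n, f (a *: m + n) = bimod_act a (f m) + f n.

Definition hom_pred : {pred M -> X} := fun f => `[< hom_linear f >].

Fact bimod_act0 a : bimod_act a (0 : X) = 0.
Proof.
by apply: (addrI (bimod_act a 0)); rewrite -bimod_actDr !addr0.
Qed.

Fact hom_pred_closed : submod_closed hom_pred.
Proof.
split=> [|b f g /asboolP fP /asboolP gP]; apply/asboolP => a m n.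
  by rewrite bimod_act0 addr0.
rewrite /= -[LHS]/(b *: f _ + g _) fP gP.
rewrite -[(b *: f + g) m]/(b *: f m + g m) -[(b *: f + g) n]/(b *: f n + g n).
by rewrite bimod_actDr bimod_actZ scalerDr addrACA.
Qed.

HB.instance Definition _ := GRing.isSubmodClosed.Build B (M -> X) hom_pred
  hom_pred_closed.

(* The B-module Hom_A(M, X) *)
Record hom := Hom { hom_val :> M -> X; _ : hom_val \in hom_pred }.

HB.instance Definition _ := [isSub for hom_val].
HB.instance Definition _ := [Choice of hom by <:].
HB.instance Definition _ := [SubChoice_isSubLmodule of hom by <:].

Lemma homP (f : hom) : hom_linear f.
Proof. by apply/asboolP; case: f. Qed.

Lemma hom_ext (f g : hom) : f =1 g -> f = g.
Proof. by move=> fg; apply/val_inj/funext. Qed.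

End Hom.

Section HomPrecomp.
Variables (A B : pzRingType) (M N : lmodType A) (X : bimod A B).
Variable u : {linear M -> N}.

Fact precomp_subproof (f : hom N X) : (fun m => f (u m)) \in @hom_pred A B M X.
Proof. by apply/asboolP => a m n; rewrite linearP homP. Qed.

Definition precomp (f : hom N X) : hom M X := Hom (precomp_subproof f).

Fact precomp_is_linear : linear precomp.
Proof. by move=> b f g; apply: hom_ext. Qed.

HB.instance Definition _ :=
  GRing.isLinear.Build B (hom N X) (hom M X) *:%R precomp precomp_is_linear.

End HomPrecomp.

(* R with its left module structure and its right action *)
Fact right_regularA (R : nzRingType) (a b : R^c) (x : R) :
  (x * (b : R)) * (a : R) = x * ((a * b : R^c) : R).
Proof. by rewrite -mulrA. Qed.
Definition right_regular (R : nzRingType) : bimod R^c R :=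
  @Bimod R^c R R^o (fun a (x : R) => x * (a : R)) (@mulr1 R)
    (@right_regularA R) (fun a b x => mulrDr x a b) (fun a x y => mulrDl x y a)
    (fun a b x => esym (mulrA b x a)).

(* R with its right module structure and its left action *)
Definition left_regular (R : nzRingType) : bimod R R^c :=
  @Bimod R R^c (R^c)^o (fun a (x : R) => a * x) (@mul1r R) (@mulrA R)
    (fun a b x => mulrDl a b x) (fun a x y => mulrDr a x y)
    (fun a (b : R^c) (x : R) => mulrA a x b).

(* Any A-module as a bimodule over A and the integers *)
Definition ab_bimod (A : nzRingType) (X : lmodType A) : bimod A int :=
  @Bimod A int (ssrint.zmodule X) (fun a (x : X) => a *: x) (@scale1r A X)
    (@scalerA A X) (fun a b x => @scalerDl A X x a b) (@scalerDr A X)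
    (fun a b x => esym (@scalerMzr A X a x b)).

(* The functorial free resolution: syz n.+1 M is the kernel of the canonical
   map from the free module on the set syz n M onto syz n M. *)
Section FreeResolution.
Variable A : nzRingType.
Implicit Types M N : lmodType A.

Definition free_aug M : {linear {malg A[M]} -> M} := free_lift (@id M).

Fixpoint syz n M : lmodType A :=
  if n is m.+1 then ker (free_aug (syz m M)) else M.

Definition res n M : lmodType A := {malg A[syz n M]}.

Definition res_d n M : {linear res n.+1 M -> res n M} :=
  ker_incl (free_aug (syz n M)) \o free_aug (syz n.+1 M).

Lemma res_d_exact n M (u : res n.+1 M) :
  res_d n M u = 0 <-> exists v, u = res_d n.+1 M v.
Proof.
have augU (L : lmodType A) (x : L) : free_aug L << x >> = x.
  exact: (free_liftU id).
split=> [du0|[v ->]] /=.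
  have u0 : free_aug (syz n.+1 M) u = 0 by exact: val_inj.
  have uK : u \in ker_pred (free_aug (syz n.+1 M)) by rewrite inE u0.
  exists << Ker uK : syz n.+2 M >>.
  by rewrite [RHS]/(ker_val _) augU.
by rewrite ker_valP.
Qed.

Definition free_map M N (f : M -> N) : {linear {malg A[M]} -> {malg A[N]}} :=
  free_lift (fun x => << f x >>).

Lemma free_aug_natural M N (f : {linear M -> N}) u :
  free_aug N (free_map f u) = f (free_aug M u).
Proof.
apply: (free_ext (f := fun u => free_aug N (free_map f u))
                 (g := fun u => f (free_aug M u))) u => [a x y|a x y|x].
- by rewrite !linearP.
- by rewrite !linearP.
- by rewrite /= !free_liftU.
Qed.

Section SyzygyMap.
Variables (M N : lmodType A) (f : {linear M -> N}).

Fact syz1_map_subproof (x : ker (free_aug M)) :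
  free_map f (val x) \in ker_pred (free_aug N).
Proof. by rewrite inE free_aug_natural ker_valP linear0. Qed.

Definition syz1_map (x : ker (free_aug M)) : ker (free_aug N) :=
  Ker (syz1_map_subproof x).

Fact syz1_map_is_linear : linear syz1_map.
Proof. by move=> a x y; apply: val_inj; rewrite /= !linearP. Qed.

HB.instance Definition _ := GRing.isLinear.Build A (ker (free_aug M))
  (ker (free_aug N)) *:%R syz1_map syz1_map_is_linear.

End SyzygyMap.

Fixpoint syz_map n M N (f : {linear M -> N}) : {linear syz n M -> syz n N} :=
  if n is m.+1 then syz1_map (syz_map m f) else f.

Definition res_map n M N (f : {linear M -> N}) : {linear res n M -> res n N} :=
  free_map (syz_map n f).

Lemma res_map_d n M N (f : {linear M -> N}) u :
  res_map n f (res_d n M u) = res_d n N (res_map n.+1 f u).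
Proof. by rewrite /= [in RHS]free_aug_natural. Qed.

End FreeResolution.

(* Ext^n_A(M, X), as the n-th cohomology of Hom_A(res _ M, X) *)
Section Ext.
Variables (A : nzRingType) (B : pzRingType) (X : bimod A B) (n : nat).

Section ExtModule.
Variable M : lmodType A.

Definition cocycle : lmodType B := ker (@precomp A B _ _ X (res_d n M)).

Definition is_coboundary (z : hom (res n M) X) : Prop :=
  match n return hom (res n M) X -> Prop with
  | 0 => fun z => z = 0
  | m.+1 => fun z => exists g : hom (res m M) X, z = precomp (res_d m M) g
  end z.

Definition coboundary : {pred cocycle} := fun z => `[< is_coboundary (val z) >].

Fact coboundary_closed : submod_closed coboundary.
Proof.
rewrite /coboundary /is_coboundary; split=> [|b u v].
  apply/asboolP; rewrite /=; case: n => // m.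
  by exists 0; rewrite linear0.
move=> /asboolP uP /asboolP vP; apply/asboolP.
have -> : val (b *: u + v) = b *: val u + val v by [].
move: (val u) (val v) uP vP.
case: n => [|m] f g; first by move=> -> ->; rewrite scaler0 addr0.
by move=> [f' ->] [g' ->]; exists (b *: f' + g'); rewrite linearP.
Qed.

HB.instance Definition _ := GRing.isSubmodClosed.Build B cocycle coboundary
  coboundary_closed.

Definition Ext : lmodType B := quotmod coboundary.

End ExtModule.

Section ExtMap.
Variables (M N : lmodType A) (f : {linear M -> N}).

Fact cocycle_map_subproof (z : cocycle N) :
  precomp (res_map n f) (val z) \in ker_pred (@precomp A B _ _ X (res_d n M)).
Proof.
rewrite inE; apply/eqP/hom_ext => u /=.
rewrite res_map_d; have /(congr1 (fun h : hom _ _ => h (res_map n.+1 f u))) :=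
  ker_valP z.
by [].
Qed.

Definition cocycle_map (z : cocycle N) : cocycle M :=
  Ker (cocycle_map_subproof z).

(* Ext^n_A(f, X) : Ext^n_A(N, X) -> Ext^n_A(M, X) *)
Definition Ext_map (x : Ext N) : Ext M := \pi_(Ext M) (cocycle_map (repr x)).


Lemma Ext_mapE z : Ext_map (\pi_(Ext N) z) = \pi_(Ext M) (cocycle_map z).
Proof.
rewrite /Ext_map; apply/quotmod_eqP.
have /quotmod_eqP : \pi_(Ext N) (repr (\pi_(Ext N) z)) = \pi_(Ext N) z.
  by rewrite reprK.
set w := repr _; move=> /asboolP wz; apply/asboolP.
have -> : val (cocycle_map w - cocycle_map z)
          = precomp (res_map n f) (val (w - z)).
  by apply: hom_ext.
move: (val (w - z)) wz; rewrite /is_coboundary /res_map.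
case: n => [|m] h; first by move=> ->; rewrite linear0.
move=> [g ->]; exists (precomp (res_map m f) g); apply: hom_ext => u.
rewrite -[LHS]/(g (res_d m N (res_map m.+1 f u))).
by rewrite -res_map_d.
Qed.

End ExtMap.
End Ext.

Notation "''Ext^' n ( M , X )" := (Ext X n M)
  (at level 8, n at level 2, format "''Ext^' n ( M ,  X )") : type_scope.
Notation "''Ext^' n ( M , X )" := (Ext X n M) : ring_scope.

Section ModuleProperties.
Variable A : nzRingType.
Implicit Types M : lmodType A.

Definition projective M : Prop :=
  forall (U V : lmodType A) (p : {linear U -> V}) (f : {linear M -> V}),
    (forall v, exists u, p u = v) ->
    exists g : {linear M -> U}, forall m, p (g m) = f m.

Definition finitely_generated M : Prop :=
  exists (n : nat) (g : 'I_n -> M),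
    forall m, exists c : 'I_n -> A, m = \sum_i c i *: g i.

Definition simple_module M : Prop :=
  (exists m : M, m != 0) /\
  forall U : {pred M}, submod_closed U ->
    (forall m, m \in U -> m = 0) \/ (forall m, m \in U).

Definition indecomposable M : Prop :=
  (exists m : M, m != 0) /\
  forall U V : {pred M}, submod_closed U -> submod_closed V ->
    (forall m, exists u v, [/\ u \in U, v \in V & m = u + v]) ->
    (forall m, m \in U -> m \in V -> m = 0) ->
    (forall m, m \in U -> m = 0) \/ (forall m, m \in V -> m = 0).

Definition right_ideal (I : {pred A}) : Prop :=
  submod_closed (I : {pred (A^c)^o}).

Definition maximal_right_ideal (I : {pred A}) : Prop :=
  [/\ right_ideal I, 1 \notin I
    & forall J : {pred A}, right_ideal J -> {subset I <= J} -> 1 \notin J ->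
        {subset J <= I}].

Definition jacobson_radical (x : A) : Prop :=
  forall I : {pred A}, maximal_right_ideal I -> x \in I.

(* The square of an ideal *)
Definition ideal_square (I : A -> Prop) (x : A) : Prop :=
  exists (n : nat) (u v : 'I_n -> A),
    [/\ forall i, I (u i), forall i, I (v i) & x = \sum_i u i * v i].

End ModuleProperties.

Section Reflexivity.
Variable R : nzRingType.

(* M^* for a right module M, and for a left module M *)
Definition rdual (M : lmodType R^c) : lmodType R := hom M (right_regular R).
Definition ldual (M : lmodType R) : lmodType R^c := hom M (left_regular R).

Variable M : lmodType R^c.

Fact ev_subproof (m : M) :
  (fun psi : rdual M => psi m) \in @hom_pred R R^c (rdual M) (left_regular R).
Proof. by apply/asboolP. Qed.

Definition ev (m : M) : ldual (rdual M) := Hom (ev_subproof m).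

Fact ev_is_linear : linear ev.
Proof. by move=> a m n; apply: hom_ext => psi /=; rewrite homP. Qed.

HB.instance Definition _ :=
  GRing.isLinear.Build R^c M (ldual (rdual M)) *:%R ev ev_is_linear.

Definition reflexive_module : Prop := bijective ev.

(* Up to projective summands, D_2(M) = M^* and D_2^2(M) = M^**, and ev represents
   the natural map M -> D_2^2(M). *)
Definition two_reflexive : Prop :=
  forall X : lmodType R^c, finitely_generated X ->
    bijective (@Ext_map _ _ (ab_bimod X) 1 _ _ ev).

End Reflexivity.

Section TheAlgebra.

Definition v1 : 'I_4 := @Ordinal 4 0 isT.
Definition v2 : 'I_4 := @Ordinal 4 1 isT.
Definition v3 : 'I_4 := @Ordinal 4 2 isT.
Definition v4 : 'I_4 := @Ordinal 4 3 isT.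

(* The arrows 0, 1, 2, 3 are a : 1 -> 2, b : 2 -> 3, c : 3 -> 4, d : 1 -> 3. *)
Definition Q4 : quiver :=
  @Quiver 'I_4 'I_4 (tnth [tuple v1; v2; v3; v1]) (tnth [tuple v2; v3; v4; v3])
    v1.

(* R is KQ/rad^2(KQ), with projection pi *)
Definition is_rad_square_zero_algebra (K : fieldType) (Q : quiver)
    (R : algType K) (pi : {lrmorphism path_algebra K Q -> R}) : Prop :=
  (forall r, exists x, pi x = r) /\
  (forall x, pi x = 0 <-> ideal_square (@jacobson_radical (path_algebra K Q)) x).

Section Dimension.
Variables (K : fieldType) (R : algType K) (M : lmodType R^c).

(* The K-subspace M.e has dimension d *)
Definition dim_at (e : R) (d : nat) : Prop :=
  exists2 b : 'I_d -> M, forall j, exists m, b j = (e : R^c) *: m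
  & forall m, exists! c : {ffun 'I_d -> K},
      (e : R^c) *: m = \sum_j (((c j)%:A : R) : R^c) *: b j.

End Dimension.

Variables (K : fieldType) (Q : quiver) (R : algType K).
Variable pi : {lrmorphism path_algebra K Q -> R}.

Definition idempotent_at (i : vertex Q) : R :=
  pi (path_basis K (trivial_path i)).

Definition has_dimension_vector (M : lmodType R^c) (d : vertex Q -> nat) : Prop :=
  forall i, dim_at M (idempotent_at i) (d i).

Definition is_simple_at (M : lmodType R^c) (i : vertex Q) : Prop :=
  simple_module M /\ exists m : M, (idempotent_at i : R^c) *: m != 0.

End TheAlgebra.

(* Main.v *)
Require Import Defs.
From HB Require Import structures.
From mathcomp Require Import all_boot all_order all_algebra.
From mathcomp Require Import boolp functions finmap monalg.
Import Defs.
Set Implicit Arguments.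
Unset Strict Implicit.
Unset Printing Implicit Defensive.
Import GRing.Theory.
Local Open Scope ring_scope.
Local Open Scope quotient_scope.

(** In R every product of two arrows vanishes, so R has the K-basis consisting
    of the four vertices e_i and the four arrows. This rests on the equality of
    the Jacobson radical of KQ with the arrow ideal. An arrow x satisfies
    x w x = 0 for every w because Q has no oriented cycle, which puts x into
    every maximal right ideal ([arrow_radical]). Conversely, taking the
    coefficient of a trivial path is a ring morphism onto K, so it kills the
    radical, and then a product of two radical elements has no arrow
    coefficient ([arrow_coef_radical_square]).

    Part 1. The module N is e_1 R / a R: if d acted as zero on N, then N would
    split into its parts at the vertices 1 and 3. Left multiplications by a, b
    and c form the projective resolution
    0 -> e_4 R -> e_3 R -> e_2 R -> e_1 R -> N -> 0. Applying Hom(-, R) gives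
    Re_1 -> Re_2 -> Re_3 -> Re_4 with right multiplications by a, b and c. In
    Re_3, with basis e_3, b, d, the kernel is spanned by b and d, and the image
    is spanned by b. Hence Ext^2(N, R) is spanned by the class of d, and this
    left module is isomorphic to the projective Re_1. The comparison between
    the free resolution that defines Ext and the resolution above is
    [Ext2_cyclic_resolution]; it holds over any ring.

    Part 2. A morphism S_3 -> R sends a generator m0 to an element of Re_3
    killed by c, so S_3^* has the basis f_b, f_d with values b and d at m0. An
    element F of S_3^** is given by F(f_b), which lies in K b, and by F(f_d),
    which may be any element of e_1 R. So S_3^** is S_3 + e_1 R, and ev sends m0
    to the pair (b, d). The element (0, e_1) is not in the image of ev, and S_3
    is not reflexive. The projection phi of S_3^** onto S_3 satisfies
    phi o ev = id, while ev o phi - id factors through the projective e_1 R.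
    Maps whose difference factors through a projective agree on Ext^1
    ([Ext1_map_homotopy]), so ev and phi induce mutually inverse maps. *)

(** * Free resolutions and functoriality of Ext *)

Section FreeModules.
Variable A : nzRingType.

Lemma free_lift_exists (T : choiceType) (V W : lmodType A) (p : {linear V -> W})
    (f : {linear {malg A[T]} -> W}) :
  (forall x, exists v, p v = f << x >>) ->
  exists g : {linear {malg A[T]} -> V}, forall u, p (g u) = f u.
Proof.
move=> /choice[g pg]; exists (free_lift g).
apply: (free_ext (f := fun u => p (free_lift g u))) => [a x y|a x y|x].
- by rewrite !linearP.
- by rewrite linearP.
by rewrite /= free_liftU.
Qed.

Lemma free_augU (M : lmodType A) (m : M) : free_aug M << m >> = m.
Proof. exact: (free_liftU id). Qed.

(** Exactness at the bottom of the resolution, which continues [res_d_exact]. *)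
Lemma free_aug_exact (M : lmodType A) (u : res 0 M) :
  free_aug M u = 0 <-> exists v, u = res_d 0 M v.
Proof.
split=> [u0|[v ->]]; last exact: ker_valP.
have uK : u \in ker_pred (free_aug M) by rewrite inE u0.
exists << Ker uK : syz 1 M >>.
by rewrite [RHS]/(ker_val _) free_augU.
Qed.

Lemma free_aug_d (M : lmodType A) u : free_aug M (res_d 0 M u) = 0.
Proof. by apply/free_aug_exact; exists u. Qed.

End FreeModules.

Section ExtFunctor.
Variables (A : nzRingType) (B : pzRingType) (X : bimod A B).
Implicit Types M N L : lmodType A.

Lemma free_map_id M u : free_map (@id M) u = u.
Proof.
apply: (free_ext (g := id)) u => [a x y|a x y|x]; rewrite ?linearP //.
exact: free_liftU.
Qed.

Lemma free_map_comp M N L (f : M -> N) (g : N -> L) u :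
  free_map (g \o f) u = free_map g (free_map f u).
Proof.
apply: (free_ext (f := free_map (g \o f)) (g := fun u => free_map g (free_map f u)))
  u => [a x y|a x y|x]; rewrite ?linearP //.
by rewrite /= !free_liftU.
Qed.

Lemma free_map_eq M N (f g : M -> N) : f =1 g -> free_map f =1 free_map g.
Proof. by move=> /funext ->. Qed.

Lemma syz_map_id n M (f : {linear M -> M}) : f =1 id -> syz_map n f =1 id.
Proof.
move=> fid; elim: n => [|n IHn] x //=; apply: val_inj => /=.
by rewrite (free_map_eq IHn) free_map_id.
Qed.

Lemma syz_map_comp n M N L (f : {linear M -> N}) (g : {linear N -> L})
    (h : {linear M -> L}) : h =1 g \o f ->
  syz_map n h =1 syz_map n g \o syz_map n f.
Proof.
move=> hE; elim: n => [|n IHn] x //=; apply: val_inj => /=.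
by rewrite (free_map_eq IHn) free_map_comp.
Qed.

Lemma Ext_class_eq n M (z w : cocycle X n M) :
  \pi_(Ext X n M) z = \pi_(Ext X n M) w <-> is_coboundary (val z - val w).
Proof.
pose i : {linear cocycle X n M -> hom (res n M) X} :=
  ker_incl (@precomp A B _ _ X (res_d n M)).
have -> : val z - val w = val (z - w) by rewrite -[RHS]/(i (z - w)) raddfB.
split=> [zw|zw].
  apply/asboolP; rewrite -[asbool _]/(z - w \in @coboundary _ _ X n M).
  exact/quotmod_eqP.
apply/quotmod_eqP; rewrite -[_ \in _]/(asbool (is_coboundary (val (z - w)))).
exact/asboolP.
Qed.

(** The free resolution is strictly functorial on linear maps, so identities and
    composites are preserved on the nose, with no homotopy involved. *)
Lemma Ext_map_id n M (f : {linear M -> M}) : f =1 id ->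
  @Ext_map _ _ X n _ _ f =1 id.
Proof.
move=> fid; elim/quotW => z; rewrite Ext_mapE; congr (\pi_(Ext X n M) _).
apply/val_inj/hom_ext => u /=.
by rewrite /res_map (free_map_eq (syz_map_id fid)) free_map_id.
Qed.

Lemma Ext_map_comp n M N L (f : {linear M -> N}) (g : {linear N -> L})
    (h : {linear M -> L}) : h =1 g \o f ->
  @Ext_map _ _ X n _ _ h =1 @Ext_map _ _ X n _ _ f \o @Ext_map _ _ X n _ _ g.
Proof.
move=> hE; elim/quotW => z; rewrite -[RHS]/(Ext_map f (Ext_map g _)).
rewrite (Ext_mapE h) (Ext_mapE g) Ext_mapE; congr (\pi_(Ext X n M) _).
apply/val_inj/hom_ext => u /=.
by rewrite /res_map (free_map_eq (syz_map_comp hE)) free_map_comp.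
Qed.

Lemma hom0 M (f : hom M X) : f 0 = 0.
Proof.
have := homP f 1 0 0; rewrite bimod_act1 scaler0 addr0 => ff.
by apply: (addrI (f 0)); rewrite addr0 -ff.
Qed.

Lemma homD M (f : hom M X) x y : f (x + y) = f x + f y.
Proof. by have := homP f 1 x y; rewrite scale1r bimod_act1. Qed.

Lemma homN M (f : hom M X) x : f (- x) = - f x.
Proof. by apply: (addIr (f x)); rewrite -homD !addNr hom0. Qed.

Lemma homZ M (f : hom M X) a x : f (a *: x) = bimod_act a (f x).
Proof. by have := homP f a x 0; rewrite hom0 !addr0. Qed.

Lemma cocycle_d n M (z : cocycle X n M) u :
  (val z : hom (res n M) X) (res_d n M u) = 0.
Proof.
by have /(congr1 (fun h : hom _ _ => h u)) := ker_valP z.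
Qed.

Lemma cocycle_ker n M (z : cocycle X n.+1 M) u :
  res_d n M u = 0 -> (val z : hom (res n.+1 M) X) u = 0.
Proof. by move=> /res_d_exact[v ->]; exact: cocycle_d. Qed.

(** The hypothesis says that [f - g] factors through the projective module
    [res 0 N]. The map [t \o free_aug M] corrects the difference of the induced
    maps in degree 0 so that its augmentation vanishes; it then lifts along
    [res_d 0 N] to [h], and composing a cocycle with [h] gives a function whose
    coboundary is the difference of the two images. *)
Lemma Ext1_map_homotopy M N (f g : {linear M -> N})
    (t : {linear M -> res 0 N}) :
  (forall m, f m - g m = free_aug N (t m)) ->
  @Ext_map _ _ X 1 _ _ f =1 @Ext_map _ _ X 1 _ _ g.
Proof.
move=> fg.
pose s : {linear res 0 M -> res 0 N} :=
  free_map f \- free_map g \- (t \o free_aug M).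
have [h hP] : exists h : {linear res 0 M -> res 1 N},
    forall u, res_d 0 N (h u) = s u.
  apply: free_lift_exists => m.
  have /free_aug_exact[v vP] : free_aug N (s << m >>) = 0.
    rewrite /s /= !raddfB /= !free_aug_natural /=.
    by rewrite -fg !free_augU subrr.
  by exists v.
elim/quotW => z; rewrite !Ext_mapE; apply/Ext_class_eq.
have zhP : (fun u => (val z : hom (res 1 N) X) (h u)) \in @hom_pred _ _ (res 0 M) X.
  by apply/asboolP => a u v; rewrite linearP homP.
exists (Hom zhP); apply: hom_ext => u.
rewrite -[LHS]/((val z : hom _ X) (res_map 1 f u) - (val z : hom _ X) (res_map 1 g u)).
rewrite -[RHS]/((val z : hom _ X) (h (res_d 0 M u))).
(* The cocycle is evaluated at an element of the kernel of [res_d 0 N]. *)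
apply/eqP; rewrite -subr_eq0 -!homN -!homD; apply/eqP/cocycle_ker.
have dB x y w x' y' w' : res_d 0 N x = x' -> res_d 0 N y = y' ->
    res_d 0 N w = w' -> x' - y' - w' = 0 -> res_d 0 N (x - y - w) = 0.
  by move=> <- <- <-; rewrite !(raddfB (res_d 0 N)).
have dmap (k : {linear M -> N}) : res_d 0 N (res_map 1 k u) = res_map 0 k (res_d 0 M u).
  exact: (esym (res_map_d k u)).
apply: (dB _ _ _ _ _ _ (dmap f) (dmap g) (hP _)).
rewrite -[s _]/(res_map 0 f _ - res_map 0 g _ - t (free_aug M _)).
by rewrite free_aug_d raddf0 subr0 subrr.
Qed.

End ExtFunctor.

(** * Second extensions of a module resolved by cyclic projectives *)

Definition ract (R : nzRingType) (M : lmodType R^c) (m : M) (r : R) : M :=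
  (r : R^c) *: m.
Local Notation "m ⋅ r" := (ract m r) (at level 40, left associativity).

Section RightAction.
Variables (R : nzRingType) (M : lmodType R^c).
Implicit Types (m : M) (r s : R).

Lemma ractM m r s : m ⋅ (r * s) = m ⋅ r ⋅ s.
Proof. by rewrite /ract scalerA. Qed.

Lemma ract1 m : m ⋅ 1 = m.
Proof. exact: scale1r. Qed.

Lemma ract0 m : m ⋅ 0 = 0.
Proof. exact: scale0r. Qed.

Lemma ract0l r : (0 : M) ⋅ r = 0.
Proof. exact: scaler0. Qed.

Lemma ractDr m r s : m ⋅ (r + s) = m ⋅ r + m ⋅ s.
Proof. exact: scalerDl. Qed.

Lemma ractBr m r s : m ⋅ (r - s) = m ⋅ r - m ⋅ s.
Proof. exact: (scalerBl (r : R^c) s m). Qed.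

Lemma ractDl m n r : (m + n) ⋅ r = m ⋅ r + n ⋅ r.
Proof. exact: scalerDr. Qed.

Lemma linear_ract (N : lmodType R^c) (f : {linear M -> N}) m r :
  f (m ⋅ r) = f m ⋅ r.
Proof. exact: linearZ. Qed.

Definition orbit_map m (r : (R^c)^o) : M := m ⋅ r.

Fact orbit_map_is_linear m : linear (orbit_map m).
Proof. by move=> a r s; rewrite /orbit_map /ract scalerDl scalerA. Qed.

HB.instance Definition _ m := GRing.isLinear.Build R^c (R^c)^o M *:%R
  (orbit_map m) (orbit_map_is_linear m).

End RightAction.

(** A form of projectivity that asks only that [p] cover the image of [f]. It
    applies directly to a differential that covers a kernel. *)
Definition lifting (A : nzRingType) (F : lmodType A) : Prop :=
  forall (V W : lmodType A) (p : {linear V -> W}) (f : {linear F -> W}),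
    (forall x, exists v, p v = f x) ->
    exists g : {linear F -> V}, forall x, p (g x) = f x.

Lemma add_sub_sub (V : zmodType) (x y z : V) : y + z + (x - y - z) = x.
Proof. by rewrite -[x - y - z]addrA -opprD [LHS]addrC subrK. Qed.

Lemma free_lifting (A : nzRingType) (T : choiceType) : lifting {malg A[T]}.
Proof. by move=> V W p f pf; apply: free_lift_exists => x; exact: pf. Qed.

Lemma quotmod_pi0 (B : pzRingType) (V : lmodType B) (I : submodClosed V) :
  \pi_(quotmod I) 0 = 0 :> quotmod I.
Proof.
by apply: (addrI (\pi_(quotmod I) 0)); rewrite -quotmod_piD !addr0.
Qed.

(** The hypotheses say that left multiplications by [b] and [a] give the start
    [e2 R -> e1 R -> e0 R -> N -> 0] of a projective resolution of [N], with
    augmentation sending [e0] to [n], and that the kernel at [e2 R] consists of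
    right multiples of [c]. *)
Section CyclicResolution.
Variables (R : nzRingType) (N : lmodType R^c).
Variables (n : N) (e0 e1 e2 a b c : R).
Hypotheses (e0e0 : e0 * e0 = e0) (e1e1 : e1 * e1 = e1) (e2e2 : e2 * e2 = e2).
Hypotheses (ne0 : n ⋅ e0 = n) (ae1 : a * e1 = a) (be2 : b * e2 = b).
Hypotheses (e0a : e0 * a = a) (e1b : e1 * b = b).
Hypotheses (na : n ⋅ a = 0) (ab : a * b = 0) (bc : b * c = 0).
Hypothesis n_gen : forall m, exists r, m = n ⋅ r.
Hypothesis n_ann : forall r, n ⋅ r = 0 -> exists s, e0 * r = a * s.
Hypothesis a_ann : forall r, a * r = 0 -> exists s, e1 * r = b * s.
Hypothesis b_ann : forall r, b * r = 0 -> exists s, e2 * r = c * s.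

Local Notation Rr := ((R^c)^o : lmodType R^c).

Section Comparison.
Variables (F0 F1 F2 F3 : lmodType R^c).
Variables (aug : {linear F0 -> N}) (d0 : {linear F1 -> F0})
  (d1 : {linear F2 -> F1}) (d2 : {linear F3 -> F2}).
Hypotheses (F0P : lifting F0) (F1P : lifting F1) (F2P : lifting F2).
Hypothesis aug_surj : forall m, exists x, aug x = m.
Hypothesis aug_ker : forall u, aug u = 0 <-> exists v, u = d0 v.
Hypothesis d0_ker : forall u, d0 u = 0 <-> exists v, u = d1 v.
Hypothesis d1_ker : forall u, d1 u = 0 <-> exists v, u = d2 v.

Let augd u : aug (d0 u) = 0. Proof. by apply/aug_ker; exists u. Qed.
Let dd0 u : d0 (d1 u) = 0. Proof. by apply/d0_ker; exists u. Qed.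
Let dd1 u : d1 (d2 u) = 0. Proof. by apply/d1_ker; exists u. Qed.

(** Comparison of an exact complex of projectives with the cyclic resolution.
    The chain map to the cyclic resolution is given by [beta0], [beta1] and
    [beta2]; the chain map back sends the generators to [x0], [x1] and [x2]. A
    cocycle [z] is determined up to a coboundary by [t = z x2], so degree 2
    cohomology is the quotient of the [t] in [R e2] with [t * c = 0] by the left
    multiples of [b]. *)
Lemma cyclic_resolution_cocycles :
  exists beta : {linear F2 -> Rr},
  [/\ forall t, t * e2 = t -> t * c = 0 -> forall u, t * beta (d2 u) = 0,
      forall z : {linear F2 -> Rr}, (forall u, z (d2 u) = 0) ->
        exists t (g : {linear F1 -> Rr}),
          [/\ t * e2 = t, t * c = 0 & forall u, z u = t * beta u + g (d1 u)]
    & forall t, t * e2 = t -> t * c = 0 ->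
        ((exists g : {linear F1 -> Rr}, forall u, t * beta u = g (d1 u)) <->
         exists s, t = s * b)].
Proof.
(* The map into the i-th projective is [e_i * beta_i u]; leaving out the
   idempotent makes each [beta_i] a lift along a map out of the regular module. *)
have [beta0 beta0P] : exists beta0 : {linear F0 -> Rr}, forall u, n ⋅ beta0 u = aug u.
  apply: (F0P (p := orbit_map n)) => u.
  by have [r rP] := n_gen (aug u); exists r.
have [beta1 beta1P] : exists beta1 : {linear F1 -> Rr},
    forall u, a * beta1 u = e0 * beta0 (d0 u).
  apply: (F1P (p := orbit_map (a : Rr)) (f := orbit_map (e0 : Rr) \o beta0 \o d0)).
  move=> u; have /n_ann[s sP] : n ⋅ (beta0 (d0 u)) = 0 by rewrite beta0P augd.
  by exists s.
have [beta2 beta2P] : exists beta2 : {linear F2 -> Rr},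
    forall u, b * beta2 u = e1 * beta1 (d1 u).
  apply: (F2P (p := orbit_map (b : Rr)) (f := orbit_map (e1 : Rr) \o beta1 \o d1)).
  move=> u; have /a_ann[s sP] : a * (beta1 (d1 u)) = 0.
    by rewrite beta1P dd0 linear0 mulr0.
  by exists s.
(* A map out of a cyclic projective is an element fixed by its idempotent. *)
have [x0 [x0e x0n]] : exists x0, x0 ⋅ e0 = x0 /\ aug x0 = n.
  have [x xn] := aug_surj n; exists (x ⋅ e0).
  by rewrite -ractM e0e0 linear_ract xn.
have [x1 [x1e x1d]] : exists x1, x1 ⋅ e1 = x1 /\ d0 x1 = x0 ⋅ a.
  have /aug_ker[x xd] : aug (x0 ⋅ a) = 0 by rewrite linear_ract x0n.
  exists (x ⋅ e1); rewrite -ractM e1e1 linear_ract -xd -ractM ae1.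
  by [].
have [x2 [x2e x2d]] : exists x2, x2 ⋅ e2 = x2 /\ d1 x2 = x1 ⋅ b.
  have /d0_ker[x xd] : d0 (x1 ⋅ b) = 0 by rewrite linear_ract x1d -ractM ab ract0.
  exists (x ⋅ e2); rewrite -ractM e2e2 linear_ract -xd -ractM be2.
  by [].
have x2c : exists v, x2 ⋅ c = d2 v.
  by apply/d1_ker; rewrite linear_ract x2d -ractM bc ract0.
exists beta2; split.
- move=> t te tc u.
  have /b_ann[s sP] : b * beta2 (d2 u) = 0 by rewrite beta2P dd1 linear0 mulr0.
  by rewrite -te -mulrA sP mulrA tc mul0r.
- move=> z zd.
  (* A homotopy from the identity to the composite of the two chain maps; its
     top part [h2] is killed by the cocycle. *)
  have [h0 h0P] : exists h0 : {linear F0 -> F1},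
      forall u, d0 (h0 u) = u - x0 ⋅ beta0 u.
    apply: (F0P (f := idfun \- (orbit_map x0 \o beta0))) => u.
    have /aug_ker[v vP] : aug (u - x0 ⋅ beta0 u) = 0.
      by rewrite linearB linear_ract x0n beta0P subrr.
    by exists v.
  have [h1 h1P] : exists h1 : {linear F1 -> F2},
      forall u, d1 (h1 u) = u - x1 ⋅ beta1 u - h0 (d0 u).
    apply: (F1P (f := idfun \- (orbit_map x1 \o beta1) \- (h0 \o d0))) => u.
    have /d0_ker[v vP] : d0 (u - x1 ⋅ beta1 u - h0 (d0 u)) = 0.
      rewrite !linearB linear_ract x1d -ractM beta1P ractM x0e h0P.
      by rewrite opprB addrCA addrAC subrr add0r subrr.
    by exists v.
  have [h2 h2P] : exists h2 : {linear F2 -> F3},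
      forall u, d2 (h2 u) = u - x2 ⋅ beta2 u - h1 (d1 u).
    apply: (F2P (f := idfun \- (orbit_map x2 \o beta2) \- (h1 \o d1))) => u.
    have /d1_ker[v vP] : d1 (u - x2 ⋅ beta2 u - h1 (d1 u)) = 0.
      rewrite !linearB linear_ract x2d -ractM beta2P ractM x1e h1P dd0 linear0 subr0.
      by rewrite subrr.
    by exists v.
  pose g : {linear F1 -> Rr} := z \o h1.
  exists (z x2), g; split=> [||u].
  + by have := congr1 z x2e; rewrite linear_ract.
  + by have [v vP] := x2c; rewrite -(zd v) -vP linear_ract.
  have := zd (h2 u); rewrite h2P !linearB linear_ract => /eqP.
  by rewrite subr_eq0 subr_eq addrC => /eqP.
move=> t te tc; split=> [[g gP]|[s ->]].
  (* The composite in the other order need not be the identity either: the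
     terms [s0], [s1] and [s2] are its homotopy, and [s1] corrects the multiple
     of [b] read off from [g]. *)
  have [s0 s0P] : exists s, e0 * beta0 x0 = e0 + a * s.
    have /n_ann[s sP] : n ⋅ (beta0 x0 - 1) = 0 by rewrite ractBr beta0P x0n ract1 subrr.
    by exists s; rewrite -sP mulrBr mulr1 addrC subrK.
  have [s1 s1P] : exists s, e1 * beta1 x1 = e1 + e1 * s0 * a + b * s.
    have /a_ann[s sP] : a * (beta1 x1 - 1 - s0 * a) = 0.
      rewrite !mulrBr mulr1 beta1P x1d linear_ract -[beta0 x0 ⋅ a]/((beta0 x0 : R) * a).
      by rewrite !mulrA s0P mulrDl e0a [a + _]addrC addrK subrr.
    by exists s; rewrite -sP !mulrBr mulr1 mulrA add_sub_sub.
  have [s2 s2P] : exists s, e2 * beta2 x2 = e2 + e2 * s1 * b + c * s.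
    have /b_ann[s sP] : b * (beta2 x2 - 1 - s1 * b) = 0.
      rewrite !mulrBr mulr1 beta2P x2d linear_ract -[beta1 x1 ⋅ b]/((beta1 x1 : R) * b).
      rewrite mulrA s1P !mulrDl e1b -!(mulrA _ a) ab mulr0 addr0.
      by rewrite [b + _]addrC addrK !mulrA subrr.
    by exists s; rewrite -sP !mulrBr mulr1 mulrA add_sub_sub.
  have := gP x2; rewrite x2d linear_ract -[g x1 ⋅ b]/((g x1 : R) * b) -{1}te -mulrA s2P.
  rewrite !mulrDr !mulrA te tc mul0r addr0 => tE.
  by exists ((g x1 : R) - t * s1); rewrite mulrBl -tE addrK.
exists (orbit_map (s * e1 : Rr) \o beta1) => u.
by rewrite -[RHS]/(s * e1 * beta1 (d1 u)) -!mulrA beta2P.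
Qed.

End Comparison.

Lemma linear_of_hom (M : lmodType R^c) (f : hom M (right_regular R)) :
  exists g : {linear M -> Rr}, forall m, g m = f m.
Proof.
have f_lin : linear (f : M -> Rr) by move=> r m m'; exact: (homP f r m m').
pose g : {linear M -> Rr} :=
  HB.pack (f : M -> Rr) (GRing.isLinear.Build R^c M Rr *:%R (f : M -> Rr) f_lin).
by exists g.
Qed.

Fact mulhom_subproof (M : lmodType R^c) (g : {linear M -> Rr}) (t : R) :
  (fun m => t * (g m : R)) \in @hom_pred R^c R M (right_regular R).
Proof.
apply/asboolP => r m m'; rewrite linearP.
by rewrite -[r *: g m]/((g m : R) * (r : R)) mulrDr mulrA.
Qed.

Definition mulhom M g t : hom M (right_regular R) := Hom (@mulhom_subproof M g t).

Let adm t := t * e2 = t /\ t * c = 0.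

(** The dual of the resolution has the terms [R e1] and [R e2], linked by right
    multiplication by [b], and the cocycles in [R e2] are the annihilator of [c];
    [Ext^2(N, R)] is the quotient, and [phi t] is the class of [t * beta]. *)
Lemma Ext2_cyclic_resolution :
  exists phi : R -> 'Ext^2(N, right_regular R),
  [/\ forall r s t, adm s -> adm t -> phi (r * s + t) = r *: phi s + phi t,
      forall x, exists t, adm t /\ x = phi t
    & forall t, adm t -> (phi t = 0 <-> exists s, t = s * b)].
Proof.
have aug_surj m : exists x, free_aug N x = m by exists << m >>; exact: free_augU.
have [beta [b_coc b_gen b_ker]] := @cyclic_resolution_cocycles
  (res 0 N) (res 1 N) (res 2 N) (res 3 N)
  (free_aug N) (res_d 0 N) (res_d 1 N) (res_d 2 N)
  (@free_lifting _ _) (@free_lifting _ _) (@free_lifting _ _)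
  aug_surj (@free_aug_exact _ N) (@res_d_exact _ 0 N) (@res_d_exact _ 1 N).
have cocP t : adm t ->
    mulhom beta t \in ker_pred (@precomp R^c R _ _ (right_regular R) (res_d 2 N)).
  by move=> [te tc]; rewrite inE; apply/eqP/hom_ext => u; exact: b_coc.
pose Z t (tP : adm t) : cocycle (right_regular R) 2 N := Ker (cocP t tP).
pose phi t : 'Ext^2(N, right_regular R) :=
  if pselect (adm t) is left tP then \pi_(Ext (right_regular R) 2 N) (Z t tP) else 0.
have phiE t (tP : adm t) : phi t = \pi_(Ext (right_regular R) 2 N) (Z t tP).
  by rewrite /phi; case: pselect => // tP'; rewrite (Prop_irrelevance tP tP').
exists phi; split.
- move=> r s t sP tP; have rstP : adm (r * s + t).
    case: sP tP => se sc [te tc].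
    by split; rewrite mulrDl -mulrA ?se ?sc ?te ?tc // mulr0 addr0.
  rewrite (phiE _ sP) (phiE _ tP) (phiE _ rstP).
  rewrite -[_ *: _]/(quotmod_scale _ _) quotmod_scaleE -quotmod_piD.
  congr (\pi_(Ext (right_regular R) 2 N) _); apply/val_inj/hom_ext => u.
  by apply: (etrans (mulrDl _ _ _)); rewrite -mulrA.
- elim/quotW => z; have [g gz] := linear_of_hom (val z).
  have [|t [g' [te tc gE]]] := b_gen g.
    by move=> u; rewrite gz; exact: (cocycle_d z).
  have tP : adm t by [].
  exists t; split=> //; rewrite (phiE _ tP); apply/Ext_class_eq.
  exists (mulhom g' 1); apply: hom_ext => u.
  rewrite -[LHS]/((val z : hom _ _) u - t * (beta u : R)) -gz gE.
  by rewrite -[RHS]/(1 * (g' (res_d 1 N u) : R)) mul1r addrAC subrr add0r.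
move=> t tP; rewrite -b_ker ?(tP.1) ?(tP.2) // (phiE _ tP) -quotmod_pi0.
split=> [/Ext_class_eq[h hP]|[g gE]].
  have [g gh] := linear_of_hom h; exists g => u.
  have /(congr1 (fun f : hom _ _ => f u)) := hP.
  rewrite -[RHS]/(h (res_d 1 N u)) -gh => <-.
  by rewrite -[RHS]/(t * (beta u : R) - 0) subr0.
apply/Ext_class_eq; exists (mulhom g 1); apply: hom_ext => u.
rewrite -[LHS]/(t * (beta u : R) - 0) -[RHS]/(1 * (g (res_d 1 N u) : R)).
by rewrite subr0 mul1r gE.
Qed.
End CyclicResolution.

(** * The Jacobson radical of a path algebra *)
Section Radical.
Variable A : nzRingType.
Implicit Types (u v r : A) (I : {pred A}).

Lemma right_idealP I : right_ideal I <->
  [/\ 0 \in I, forall u v, u \in I -> v \in I -> u + v \in I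
    & forall u r, u \in I -> u * r \in I].
Proof.
split=> [[I0 IP]|[I0 ID IM]].
  split=> // [u v uI vI|u r uI].
    by have := IP 1 u v uI vI; rewrite scale1r.
  by have := IP r u 0 uI I0; rewrite addr0.
by split=> // r u v uI vI; apply: ID => //; exact: IM.
Qed.

Lemma jacobson_radicalM u r : jacobson_radical u -> jacobson_radical (u * r).
Proof.
move=> uJ I I_max; have [/right_idealP[_ _ IM] _ _] := I_max.
exact/IM/uJ.
Qed.

(** If a maximal right ideal missed [u], then [1 - u * r] would lie in it for
    some [r]; but [1 - u * r] has the right inverse [1 + u * r]. *)
Lemma jacobson_radical_sandwich u :
  (forall r, u * r * u = 0) -> jacobson_radical u.
Proof.
move=> uru I [/right_idealP[I0 ID IM] I1 I_max]; apply: contraNT I1 => uI.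
pose J : {pred A} := [pred v | `[< exists r, v - u * r \in I >]].
have J_ideal : right_ideal J.
  apply/right_idealP; split.
  - by apply/asboolP; exists 0; rewrite mulr0 subr0.
  - move=> v w /asboolP[r rI] /asboolP[s sI]; apply/asboolP; exists (r + s).
    by rewrite mulrDr opprD addrACA ID.
  - move=> v s /asboolP[r rI]; apply/asboolP; exists (r * s).
    by rewrite mulrA -mulrBl IM.
have IJ : {subset I <= J}.
  by move=> v vI; apply/asboolP; exists 0; rewrite mulr0 subr0.
have uJ : u \in J by apply/asboolP; exists 1; rewrite mulr1 subrr.
have /asboolP[r rI] : 1 \in J.
  by apply: contraNT uI => J1; exact: (I_max J J_ideal IJ J1).
have := IM _ (1 + u * r) rI.
by rewrite mulrBl mul1r mulrDr mulr1 mulrA uru mul0r addr0 addrK.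
Qed.

(** The kernel of a ring morphism onto a field is a maximal right ideal; [s] is
    any section of [chi]. *)
Lemma jacobson_radical_kernel (K : fieldType) (chi : A -> K) (s : K -> A) u :
    (forall v w, chi (v + w) = chi v + chi w) ->
    (forall v w, chi (v * w) = chi v * chi w) -> (forall k, chi (s k) = k) ->
  jacobson_radical u -> chi u = 0.
Proof.
move=> chiD chiM chis.
have chi0 : chi 0 = 0 by apply: (addrI (chi 0)); rewrite -chiD !addr0.
have chi1 : chi 1 = 1.
  by have := chiM (s 1) 1; rewrite mulr1 chis mul1r => <-.
have chiN v : chi (- v) = - chi v.
  by apply: (addIr (chi v)); rewrite -chiD !addNr.
pose I : {pred A} := [pred v | chi v == 0].
suff I_max : maximal_right_ideal I by move=> /(_ _ I_max) /eqP.
split; last 2 first.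
- by rewrite inE chi1 oner_eq0.
- move=> J /right_idealP[J0 JD JM] IJ J1 v vJ; rewrite inE.
  apply: contraNT J1 => v0; pose k := s (chi v)^-1.
  have rI : 1 - v * k \in J.
    by apply: IJ; rewrite inE chiD chiN chiM chis chi1 mulfV // subrr.
  by rewrite -(subrK (v * k) 1) JD // JM.
apply/right_idealP; split=> [|v w|v r]; rewrite !inE ?chi0 //.
  by rewrite chiD => /eqP-> /eqP->; rewrite addr0.
by rewrite chiM => /eqP->; rewrite mul0r.
Qed.

End Radical.

Section PathAlgebraRadical.
Variables (K : fieldType) (Q : quiver).
Local Notation KQ := (path_algebra K Q).
Local Notation bas := (@path_basis K Q).
Implicit Types (p q : qpath Q) (i j : vertex Q) (x y : arrow Q).

Lemma path_basisM p q : bas p * bas q = path_mul K p q.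
Proof. exact: path_algebra_mulE. Qed.

Lemma path_basisM_cat p q (r : qpath Q) : path_target p = path_source q ->
  (path_source p, path_arrows p ++ path_arrows q) = val r ->
  bas p * bas q = bas r.
Proof.
move=> pq pqr; apply: (etrans (path_basisM p q)); rewrite /path_mul.
case: eqP => [e|/(_ pq) []]; congr bas; exact: val_inj.
Qed.

Lemma path_basisM0 p q : path_target p <> path_source q -> bas p * bas q = 0.
Proof.
by move=> pq; apply: (etrans (path_basisM p q)); rewrite /path_mul; case: eqP.
Qed.

Lemma path_algebra_ind (P : KQ -> Prop) : P 0 ->
  (forall k p v, P v -> P (k *: bas p + v)) -> forall u, P u.
Proof.
move=> P0 PD u; have -> : u = \sum_(p <- msupp u) u@_p *: bas p.
  rewrite {1}[u]monalgE; apply: eq_bigr => p _; apply/malgP => q.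
  apply: (etrans (mcoeffU _ _ _)); apply: (etrans _ (esym (mcoeffZ _ _ _))).
  by apply: (etrans _ (esym (congr1 _ (mcoeffU _ _ _)))); rewrite mulrnAr mulr1.
elim/big_rec: _ => [|p v _]; [exact: P0|exact: PD].
Qed.

Lemma path_algebra_ext (V : lmodType K) (F G : KQ -> V) : linear F -> linear G ->
  (forall p, F (bas p) = G (bas p)) -> F =1 G.
Proof. exact: free_ext. Qed.

Lemma coef_path_mul p q (r : qpath Q) : (path_mul K p q)@_r =
  ((path_target p == path_source q) &&
   ((path_source p, path_arrows p ++ path_arrows q) == val r))%:R.
Proof.
rewrite /path_mul; case: eqP => [pq|_]; last by rewrite mcoeff0.
by rewrite mcoeffU -mulr_natr mul1r.
Qed.

Lemma coef_basisM p q (r : qpath Q) : (bas p * bas q)@_r =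
  ((path_target p == path_source q) &&
   ((path_source p, path_arrows p ++ path_arrows q) == val r))%:R.
Proof. by rewrite -coef_path_mul -path_basisM. Qed.

Lemma coef_basis p q : (bas p)@_q = (p == q)%:R.
Proof. by rewrite mcoeffU -mulr_natr mul1r. Qed.

Lemma coef_basis2 p q (r s : qpath Q) :
  (bas p)@_r * (bas q)@_s = ((p == r) && (q == s))%:R.
Proof.
apply: (etrans (congr2 *%R (coef_basis p r) (coef_basis q s))).
by rewrite -natrM mulnb.
Qed.

Lemma mulKQ_linearl (u : KQ) : linear (fun v : KQ => v * u).
Proof. exact: path_algebra_mul_linearl. Qed.

Lemma mulKQ_linearr (u : KQ) : linear (fun v : KQ => u * v).
Proof. exact: path_algebra_mul_linearr. Qed.

Lemma bilinear_form_ext (F G : KQ -> KQ -> K) :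
    (forall v, linear (F^~ v : KQ -> K^o)) -> (forall u, linear (F u : KQ -> K^o)) ->
    (forall v, linear (G^~ v : KQ -> K^o)) -> (forall u, linear (G u : KQ -> K^o)) ->
    (forall p q, F (bas p) (bas q) = G (bas p) (bas q)) ->
  forall u v, F u v = G u v.
Proof.
move=> Fl Fr Gl Gr FG u v; move: u.
apply: (@path_algebra_ext K^o) => // p; move: v.
by apply: (@path_algebra_ext K^o).
Qed.

Lemma coef_linear p : linear (fun u : KQ => u@_p : K^o).
Proof. by move=> a u v; rewrite mcoeffD mcoeffZ. Qed.

(** Only a product of trivial paths is trivial, so the coefficient of a trivial
    path is multiplicative. *)
Lemma coef_mul_trivial (u v : KQ) i :
  (u * v)@_(trivial_path i) = u@_(trivial_path i) * v@_(trivial_path i).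
Proof.
apply: (bilinear_form_ext (F := fun u v => (u * v)@_(trivial_path i))
  (G := fun u v => u@_(trivial_path i) * v@_(trivial_path i))) u v.
- by move=> w a u v /=; rewrite mulKQ_linearl coef_linear.
- by move=> w a u v /=; rewrite mulKQ_linearr coef_linear.
- by move=> w a u v /=; rewrite mcoeffD mcoeffZ mulrDl -mulrA.
- by move=> w a u v /=; rewrite mcoeffD mcoeffZ mulrDr mulrCA.
move=> p q.
apply: (etrans (coef_basisM p q _)); apply: (etrans _ (esym (coef_basis2 p q _ _))).
congr (_%:R); congr nat_of_bool.
rewrite -!val_eqE /path_target /walk_end /path_source /path_arrows /=.
case: (val p) (val q) => [i1 s1] [i2 s2] /=; rewrite !xpair_eqE.
case: s1 s2 => [|x s1] [|y s2]; rewrite ?andbF //= !andbT.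
by case: (i1 =P i) => [->|_]; rewrite ?andbF //= andbT eq_sym.
Qed.

(** An arrow factors as a product of two paths in exactly two ways, both with a
    trivial factor. *)
Lemma coef_mul_arrow (u v : KQ) x :
  (u * v)@_(arrow_path x) = u@_(trivial_path (source x)) * v@_(arrow_path x)
    + u@_(arrow_path x) * v@_(trivial_path (target x)).
Proof.
apply: (bilinear_form_ext (F := fun u v => (u * v)@_(arrow_path x))
  (G := fun u v => u@_(trivial_path (source x)) * v@_(arrow_path x)
    + u@_(arrow_path x) * v@_(trivial_path (target x)))) u v.
- by move=> w a u v /=; rewrite mulKQ_linearl coef_linear.
- by move=> w a u v /=; rewrite mulKQ_linearr coef_linear.
- by move=> w a u v /=; rewrite !mcoeffD !mcoeffZ !mulrDl -!mulrA addrACA -mulrDr.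
- by move=> w a u v /=; rewrite !mcoeffD !mcoeffZ !mulrDr !(mulrCA _ a) addrACA -mulrDr.
move=> p q; apply: (etrans (coef_basisM p q _)).
apply: (etrans _ (esym (congr2 +%R (coef_basis2 p q _ _) (coef_basis2 p q _ _)))).
rewrite -natrD.
congr (_%:R).
have := valP p; have := valP q.
rewrite -!val_eqE /path_target /walk_end /path_source /path_arrows /=.
case: (val p) (val q) => [i1 s1] [i2 s2] /=; rewrite !xpair_eqE.
case: s1 s2 => [|y s1] [|z s2]; rewrite /= ?andbF ?addn0 ?andbT //.
- by move=> _ _; case: (i1 =P source x) => [->|_]; rewrite ?andbF //= eq_sym.
- move=> _ _; rewrite cats0 add0n; case: (y :: s1 =P [:: x]) => [[-> ->]|_] /=.
    by rewrite !andbT andbC [_ == i2]eq_sym.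
  by rewrite !andbF.
by move=> _ _; case: s1 => [|? ?] /=; rewrite /= eqseq_cons !andbF.
Qed.

Definition vertex_coef i (u : KQ) : K := u@_(trivial_path i).
Definition arrow_coef x (u : KQ) : K := u@_(arrow_path x).

Lemma vertex_coefD i u v : vertex_coef i (u + v) = vertex_coef i u + vertex_coef i v.
Proof. exact: mcoeffD. Qed.
Lemma vertex_coefZ i k u : vertex_coef i (k *: u) = k * vertex_coef i u.
Proof. exact: mcoeffZ. Qed.
Lemma vertex_coefM i u v : vertex_coef i (u * v) = vertex_coef i u * vertex_coef i v.
Proof. exact: coef_mul_trivial. Qed.
Lemma vertex_coef_trivial i : vertex_coef i (bas (trivial_path i)) = 1.
Proof. by apply: (etrans (coef_basis _ _)); rewrite eqxx. Qed.
Lemma arrow_coefD x u v : arrow_coef x (u + v) = arrow_coef x u + arrow_coef x v.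
Proof. exact: mcoeffD. Qed.
Lemma arrow_coef0 x : arrow_coef x 0 = 0.
Proof. exact: mcoeff0. Qed.
Lemma arrow_coefM x u v : arrow_coef x (u * v) =
  vertex_coef (source x) u * arrow_coef x v + arrow_coef x u * vertex_coef (target x) v.
Proof. exact: coef_mul_arrow. Qed.
Lemma arrow_coef_arrow x : arrow_coef x (bas (arrow_path x)) = 1.
Proof. by apply: (etrans (coef_basis _ _)); rewrite eqxx. Qed.

Lemma vertex_coef_radical (u : KQ) i : jacobson_radical u -> vertex_coef i u = 0.
Proof.
apply: (jacobson_radical_kernel (s := fun k => k *: bas (trivial_path i))).
- exact: vertex_coefD.
- exact: vertex_coefM.
- by move=> k; rewrite vertex_coefZ vertex_coef_trivial mulr1.
Qed.

Lemma arrow_coef_radical_square (u : KQ) x :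
  ideal_square (@jacobson_radical KQ) u -> arrow_coef x u = 0.
Proof.
move=> [m [v [w [vJ wJ ->]]]].
elim/big_rec: _ => [|i y _ IH]; first exact: arrow_coef0.
rewrite arrow_coefD IH arrow_coefM (vertex_coef_radical _ (vJ i)).
by rewrite (vertex_coef_radical _ (wJ i)) mulr0 mul0r !addr0.
Qed.

Lemma path_basis_cons x (p : qpath Q) s :
  val p = (source x, x :: s) ->
  exists q : qpath Q, val q = (target x, s) /\ bas p = bas (arrow_path x) * bas q.
Proof.
move=> pE; have := valP p; rewrite pE /= eqxx /= => sP.
exists (QPath (sP : is_walk (target x, s).1 (target x, s).2)); split=> //.
by apply/esym/path_basisM_cat; rewrite //= pE.
Qed.

Section Acyclic.
Variable height : vertex Q -> nat.
Hypothesis height_arrow : forall x, (height (source x) < height (target x))%N.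

Lemma height_path p : (height (path_source p) <= height (path_target p))%N.
Proof.
rewrite /path_target /path_source /path_arrows; move: (valP p).
case: (val p) => i s /=; elim: s i => [//|x s IH] i /= /andP[/eqP <- /IH].
by apply: leq_trans; exact: ltnW.
Qed.

(** A path between two occurrences of the same arrow would go from a higher
    vertex to a lower one. *)
Lemma arrow_sandwich x (w : KQ) : bas (arrow_path x) * w * bas (arrow_path x) = 0.
Proof.
apply: (path_algebra_ext (F := fun w => bas (arrow_path x) * w * bas (arrow_path x))
  (G := fun=> 0)) w => [k u v|k u v|p].
- by rewrite mulrDr mulrDl -scalerAr -scalerAl.
- by rewrite scaler0 addr0.
rewrite path_basisM /path_mul; case: eqP => [xp|_]; last by rewrite mul0r.
rewrite path_basisM /path_mul; case: eqP => // px.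
have tp := etrans (esym (path_cat_target xp)) px.
have := height_path p; rewrite tp -xp.
by rewrite leqNgt height_arrow.
Qed.

Lemma arrow_radical x : jacobson_radical (bas (arrow_path x)).
Proof. exact/jacobson_radical_sandwich/arrow_sandwich. Qed.

(** The first arrow and the rest of the path, which starts with the second
    arrow, both lie in the radical. *)
Lemma long_path_radical_square (p : qpath Q) : (1 < size (path_arrows p))%N ->
  ideal_square (@jacobson_radical KQ) (bas p).
Proof.
case pE: (val p) => [i [|x [|y s]]]; rewrite /path_arrows pE //= => _.
have ix : i = source x by have := valP p; rewrite pE /= => /andP[/eqP].
have xy : target x = source y by have := valP p; rewrite pE /= => /andP[_ /andP[/eqP]].
rewrite ix in pE; have [q [qE ->]] := path_basis_cons pE.
rewrite xy in qE; have [q' [_ ->]] := path_basis_cons qE.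
exists 1, (fun=> bas (arrow_path x)), (fun=> bas (arrow_path y) * bas q').
split=> [_|_|]; first exact: arrow_radical.
  exact/jacobson_radicalM/arrow_radical.
by rewrite big_ord1.
Qed.

End Acyclic.
End PathAlgebraRadical.

(** * Algebras with radical square zero *)

(** When every vertex meets an arrow and no two arrows are parallel, as for the
    quiver [Q4], these conditions imply that the vertices and the arrows form a
    basis of [R]: products with idempotents separate them. *)
Record rad_square_zero_basis (K : fieldType) (Q : quiver) (R : algType K)
    (E : vertex Q -> R) (Y : arrow Q -> R) : Prop := RadSquareZeroBasis {
  vertexM i : E i * E i = E i;
  vertexM0 i j : i != j -> E i * E j = 0;
  vertex_sum : \sum_i E i = 1;
  source_arrow x : E (source x) * Y x = Y x;
  arrow_target x : Y x * E (target x) = Y x;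
  arrowM x y : Y x * Y y = 0;
  arrow_neq0 x : Y x != 0;
  vertex_arrow_span r : exists (k : vertex Q -> K) (l : arrow Q -> K),
    r = \sum_i k i *: E i + \sum_x l x *: Y x
}.

Section Presentation.
Variables (K : fieldType) (Q : quiver) (R : algType K).
Variable pi : {lrmorphism path_algebra K Q -> R}.
Hypothesis R_def : is_rad_square_zero_algebra pi.
Variable height : vertex Q -> nat.
Hypothesis height_arrow : forall x, (height (source x) < height (target x))%N.
Local Notation KQ := (path_algebra K Q).
Local Notation bas := (@path_basis K Q).

Lemma rad_square_zero_basisP : rad_square_zero_basis (idempotent_at pi)
  (fun x => pi (bas (arrow_path x))).
Proof.
have [pi_surj pi_ker] := R_def.
have pi0 u : ideal_square (@jacobson_radical KQ) u -> pi u = 0 by move/pi_ker.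
rewrite /idempotent_at; split.
- by move=> i; rewrite -rmorphM; congr (pi _); exact: path_basisM_cat.
- move=> i j /eqP ij; rewrite -rmorphM -[RHS](rmorph0 pi); congr (pi _).
  exact: path_basisM0.
- by rewrite -(rmorph_sum pi) -(rmorph1 pi).
- by move=> x; rewrite -rmorphM; congr (pi _); exact: path_basisM_cat.
- by move=> x; rewrite -rmorphM; congr (pi _); exact: path_basisM_cat.
- move=> x y; rewrite -rmorphM; apply: pi0.
  exists 1, (fun=> bas (arrow_path x)), (fun=> bas (arrow_path y)).
  by split=> [_|_|]; rewrite ?big_ord1 //; exact: arrow_radical height_arrow _.
- move=> x; apply/eqP => /pi_ker/arrow_coef_radical_square - /(_ x)/eqP.
  by rewrite arrow_coef_arrow oner_eq0.
move=> r; have [u <-] := pi_surj r.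
elim/path_algebra_ind: u {r} => [|c p v [k [l vE]]].
  exists (fun=> 0), (fun=> 0); rewrite raddf0.
  by rewrite !big1 ?addr0 // => *; rewrite scale0r.
rewrite linearD linearZ /= vE; case pE: (val p) => [i [|x [|y s]]].
- have -> : p = trivial_path i by apply: val_inj.
  exists (fun j => (j == i)%:R * c + k j), l; rewrite addrA; congr (_ + _).
  rewrite [RHS](eq_bigr (fun j => ((j == i)%:R * c) *: pi (bas (trivial_path j))
    + k j *: pi (bas (trivial_path j)))); last by move=> j _; rewrite scalerDl.
  rewrite big_split /=; congr (_ + _); rewrite (bigD1 i) //= eqxx mul1r big1 ?addr0 //.
  by move=> j /negPf->; rewrite mul0r scale0r.
- have ix : i = source x by have := valP p; rewrite pE /= => /andP[/eqP].
  have -> : p = arrow_path x by apply: val_inj; rewrite pE ix.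
  exists k, (fun y => (y == x)%:R * c + l y); rewrite addrCA; congr (_ + _).
  rewrite [RHS](eq_bigr (fun y => ((y == x)%:R * c) *: pi (bas (arrow_path y))
    + l y *: pi (bas (arrow_path y)))); last by move=> y _; rewrite scalerDl.
  rewrite big_split /=; congr (_ + _); rewrite (bigD1 x) //= eqxx mul1r big1 ?addr0 //.
  by move=> y /negPf->; rewrite mul0r scale0r.
have p0 : pi (bas p) = 0.
  apply: pi0; apply: (@long_path_radical_square K Q height height_arrow).
  by rewrite /path_arrows pE.
exists k, l; rewrite (_ : c *: pi (bas p) = 0) ?add0r //.
by rewrite p0 scaler0.
Qed.
End Presentation.

Section MultiplicationTable.
Variables (K : fieldType) (Q : quiver) (R : algType K).
Variables (E : vertex Q -> R) (Y : arrow Q -> R).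
Hypothesis EY : rad_square_zero_basis E Y.

Lemma vertex_vertex i j : E i * E j = if i == j then E i else 0.
Proof. by case: eqP => [<-|/eqP ij]; rewrite ?(vertexM EY) ?(vertexM0 EY). Qed.

Lemma vertex_arrow i x : E i * Y x = if source x == i then Y x else 0.
Proof.
rewrite -(source_arrow EY x) mulrA vertex_vertex eq_sym.
by case: eqP => [->|_]; rewrite ?mul0r.
Qed.

Lemma arrow_vertex x i : Y x * E i = if target x == i then Y x else 0.
Proof.
rewrite -(arrow_target EY x) -mulrA vertex_vertex.
by case: eqP => [->|_]; rewrite ?mulr0.
Qed.

(** Products with vertices and arrows only see some of the coordinates of [r];
    in particular [r] multiplies an arrow by a scalar on either side. *)
Lemma mul_coordinates r : exists (k : vertex Q -> K) (l : arrow Q -> K),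
  [/\ forall i, E i * r = k i *: E i + \sum_(x | source x == i) l x *: Y x,
      forall i, r * E i = k i *: E i + \sum_(x | target x == i) l x *: Y x,
      forall x, Y x * r = k (target x) *: Y x
    & forall x, r * Y x = k (source x) *: Y x].
Proof.
have [k [l ->]] := vertex_arrow_span EY r; exists k, l; split=> z.
- rewrite mulrDr !mulr_sumr (bigD1 z) //= -scalerAr (vertexM EY) big1.
    rewrite addr0; congr (_ + _); rewrite [RHS]big_mkcond; apply: eq_bigr => x _.
    by rewrite -scalerAr vertex_arrow; case: eqP; rewrite ?scaler0.
  by move=> j; rewrite eq_sym -scalerAr => /(vertexM0 EY)->; rewrite scaler0.
- rewrite mulrDl !mulr_suml (bigD1 z) //= -scalerAl (vertexM EY) big1.
    rewrite addr0; congr (_ + _); rewrite [RHS]big_mkcond; apply: eq_bigr => x _.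
    by rewrite -scalerAl arrow_vertex; case: eqP; rewrite ?scaler0.
  by move=> j; rewrite -scalerAl => /(vertexM0 EY)->; rewrite scaler0.
- rewrite mulrDr !mulr_sumr [X in _ + X]big1 ?addr0; last first.
    by move=> x _; rewrite -scalerAr (arrowM EY) scaler0.
  rewrite (bigD1 (target z)) //= -scalerAr (arrow_target EY) big1 ?addr0 //.
  by move=> j /negPf jz; rewrite -scalerAr arrow_vertex eq_sym jz scaler0.
rewrite mulrDl !mulr_suml [X in _ + X]big1 ?addr0; last first.
  by move=> x _; rewrite -scalerAl (arrowM EY) scaler0.
rewrite (bigD1 (source z)) //= -scalerAl (source_arrow EY) big1 ?addr0 //.
by move=> j /negPf jz; rewrite -scalerAl vertex_arrow eq_sym jz scaler0.
Qed.

Lemma arrow_eq0 k x : k *: Y x = 0 -> k = 0.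
Proof. by move/eqP; rewrite scaler_eq0 (negPf (arrow_neq0 EY x)) orbF => /eqP. Qed.

End MultiplicationTable.

(** Such an [M] is isomorphic to [A e] by [r e |-> r xi]; a lift of a map [f]
    is determined by [e *: u0], where [u0] is any preimage of [f xi]. *)
Lemma idempotent_cyclic_projective (A : nzRingType) (M : lmodType A) (xi : M) (e : A) :
    e *: xi = xi -> (forall m, exists r, m = r *: xi) ->
    (forall r, r *: xi = 0 -> r * e = 0) ->
  projective M.
Proof.
move=> exi /choice[coef coefE] ann U V p f p_surj.
have [u0 u0E] := p_surj (f xi).
pose g m := coef m *: (e *: u0).
have g_lin : linear g.
  move=> s m n; apply/eqP; rewrite /g scalerA -scalerDl -subr_eq0 -scalerBl scalerA.
  rewrite ann ?scale0r //.
  by rewrite scalerBl scalerDl -scalerA -!coefE subrr.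
pose G : {linear M -> U} := HB.pack g (GRing.isLinear.Build A M U *:%R g g_lin).
exists G => m.
by rewrite -[LHS]/(p (coef m *: (e *: u0))) !linearZ /= u0E -!linearZ /= exi -coefE.
Qed.

Section AlgebraAction.
Variables (K : fieldType) (R : algType K) (M : lmodType R^c).
Implicit Types (m : M) (r : R) (k : K).

Lemma ractZ m k r : m ⋅ (k *: r) = m ⋅ r ⋅ k%:A.
Proof. by rewrite -ractM mulr_algr. Qed.

Lemma ract_alg_eq0 m k : m != 0 -> m ⋅ k%:A = 0 -> k = 0.
Proof.
move=> m0 mk; apply: contra_neq_eq m0 => k0.
have := congr1 (fun x => x ⋅ (k^-1)%:A) mk.
by rewrite /= ract0l -ractM mulr_algl scalerA mulfV // scale1r ract1.
Qed.

Lemma ract_algD m k l : m ⋅ (k + l)%:A = m ⋅ k%:A + m ⋅ l%:A.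
Proof. by rewrite scalerDl ractDr. Qed.

Lemma dim_at0 (e : R) : dim_at M e 0 -> forall m, m ⋅ e = 0.
Proof. by move=> [v _ vP] m; have [f [fE _]] := vP m; rewrite /ract fE big_ord0. Qed.

Lemma dim_at1 (e : R) : e * e = e -> dim_at M e 1 ->
  exists n, [/\ n != 0, n ⋅ e = n & forall m, exists k, m ⋅ e = n ⋅ k%:A].
Proof.
move=> ee [v vM vP]; have [m0 v0] := vM ord0; exists (v ord0); split.
- apply/eqP => v00; have [f [_ f_uniq]] := vP 0.
  have all_f (g : {ffun 'I_1 -> K}) : f = g.
    by apply: f_uniq; rewrite big_ord1 v00 !scaler0.
  have := congr1 (fun g : {ffun 'I_1 -> K} => g ord0)
    (etrans (esym (all_f [ffun=> 1])) (all_f [ffun=> 0])).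
  by rewrite !ffunE => /eqP; rewrite oner_eq0.
- by rewrite v0 -[_ *: m0]/(m0 ⋅ e) -ractM ee.
by move=> m; have [f [fE _]] := vP m; exists (f ord0); rewrite /ract fE big_ord1.
Qed.

End AlgebraAction.

(** * Duals and biduals of right modules *)
Section Duality.
Variables (R : nzRingType) (M : lmodType R^c).
Implicit Types (m n : M) (r : R) (f g : rdual M) (F G : ldual (rdual M)).

Lemma rdual_act f m r : f (m ⋅ r) = (f m : R) * r.
Proof. exact: homZ. Qed.
Lemma rdualZ f r m : (r *: f) m = r * (f m : R).
Proof. by []. Qed.
Lemma rdualD f g m : (f + g) m = (f m : R) + (g m : R).
Proof. by []. Qed.
Lemma bidualZ F r f : F (r *: f) = r * (F f : R).
Proof. exact: homZ. Qed.
Lemma bidualD F f g : F (f + g) = (F f : R) + (F g : R).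
Proof. exact: homD. Qed.
Lemma bidual0 F : F 0 = 0.
Proof. exact: hom0. Qed.
Lemma bidual_act F r f : (F ⋅ r) f = (F f : R) * r.
Proof. by []. Qed.
Lemma bidual_add F G f : (F + G) f = (F f : R) + (G f : R).
Proof. by []. Qed.
Lemma bidual_sub F G f : (F - G) f = (F f : R) - (G f : R).
Proof. by []. Qed.

Fact bidual_eval_is_linear f :
  linear (fun F : ldual (rdual M) => (F f : (R^c)^o)).
Proof. by []. Qed.

Definition bidual_eval f : {linear ldual (rdual M) -> (R^c)^o} :=
  HB.pack (fun F : ldual (rdual M) => (F f : (R^c)^o))
    (GRing.isLinear.Build R^c (ldual (rdual M)) (R^c)^o *:%R
       (fun F : ldual (rdual M) => (F f : (R^c)^o)) (bidual_eval_is_linear f)).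

End Duality.

(** * The algebra of the quiver with arrows a, b, c and d *)
Section Q4Modules.
Variables (K : fieldType) (R : algType K).
Variables (E : vertex Q4 -> R) (Y : arrow Q4 -> R).
Hypothesis EY : rad_square_zero_basis E Y.

Local Notation e1 := (E v1).
Local Notation e2 := (E v2).
Local Notation e3 := (E v3).
Local Notation e4 := (E v4).
Local Notation a := (Y v1).
Local Notation b := (Y v2).
Local Notation c := (Y v3).
Local Notation d := (Y v4).

(** [mul_coordinates] written out; the arrows are indexed by the same type as
    the vertices, which is why [a], [b], [c], [d] stand for values at [v1], [v2],
    [v3], [v4]. *)
Lemma Q4_coordinates r : exists k1 k2 k3 k4 la lb lc ld : K,
  [/\ [/\ e1 * r = k1 *: e1 + la *: a + ld *: d, e2 * r = k2 *: e2 + lb *: b,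
          e3 * r = k3 *: e3 + lc *: c & e4 * r = k4 *: e4],
      r * e1 = k1 *: e1 /\ r * e3 = k3 *: e3 + lb *: b + ld *: d,
      [/\ a * r = k2 *: a, b * r = k3 *: b, c * r = k4 *: c & d * r = k3 *: d]
    & [/\ r * a = k1 *: a, r * b = k2 *: b, r * c = k3 *: c & r * d = k1 *: d]].
Proof.
have [k [l [Er rE Yr rY]]] := mul_coordinates EY r.
have arrows4 (P : pred 'I_4) (F : 'I_4 -> R) :
  \sum_(x | P x) F x = (if P v1 then F v1 else 0) + ((if P v2 then F v2 else 0)
    + ((if P v3 then F v3 else 0) + (if P v4 then F v4 else 0))).
  have -> : v1 = ord0 by apply: val_inj.
  have -> : v2 = lift ord0 ord0 by apply: val_inj.
  have -> : v3 = lift ord0 (lift ord0 ord0) by apply: val_inj.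
  have -> : v4 = lift ord0 (lift ord0 (lift ord0 ord0)) by apply: val_inj.
  by rewrite big_mkcond !big_ord_recl big_ord0 /= addr0.
exists (k v1), (k v2), (k v3), (k v4), (l v1), (l v2), (l v3), (l v4).
split; [split|split|split|split];
  first [exact: (Yr v1)|exact: (Yr v2)|exact: (Yr v3)|exact: (Yr v4)
        |exact: (rY v1)|exact: (rY v2)|exact: (rY v3)|exact: (rY v4)|idtac].
- by rewrite (Er v1) arrows4 /= !add0r addrA.
- by rewrite (Er v2) arrows4 /= !add0r !addr0.
- by rewrite (Er v3) arrows4 /= !add0r !addr0.
- by rewrite (Er v4) arrows4 /= !addr0.
- by rewrite (rE v1) arrows4 /= !addr0.
- by rewrite (rE v3) arrows4 /= !add0r addrA.
Qed.

Let e1a : e1 * a = a := source_arrow EY v1.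
Let e2b : e2 * b = b := source_arrow EY v2.
Let e1d : e1 * d = d := source_arrow EY v4.
Let ae2 : a * e2 = a := arrow_target EY v1.
Let be3 : b * e3 = b := arrow_target EY v2.
Let ce4 : c * e4 = c := arrow_target EY v3.
Let de3 : d * e3 = d := arrow_target EY v4.
Let e31 : e3 * e1 = 0. Proof. exact: (vertexM0 EY). Qed.
Let e13 : e1 * e3 = 0. Proof. exact: (vertexM0 EY). Qed.
Let e34 : e3 * e4 = 0. Proof. exact: (vertexM0 EY). Qed.

Let e1b : e1 * b = 0. Proof. by rewrite -e2b mulrA (vertexM0 EY) ?mul0r. Qed.

(** Exactness at [e2 R] and [e3 R] of the complex of left multiplications by
    [a], [b] and [c]: the annihilator of an arrow in the projective at its
    target is the radical of that projective, spanned by the next arrow. *)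
Lemma a_exact r : a * r = 0 -> exists s, e2 * r = b * s.
Proof.
have [k1 [k2 [k3 [k4 [la [lb [lc [ld [[_ e2r _ _] _ [ar _ _ _] _]]]]]]]]] :=
  Q4_coordinates r.
rewrite ar => /(arrow_eq0 EY) k20; exists lb%:A.
by rewrite e2r k20 scale0r add0r mulr_algr.
Qed.

Lemma b_exact r : b * r = 0 -> exists s, e3 * r = c * s.
Proof.
have [k1 [k2 [k3 [k4 [la [lb [lc [ld [[_ _ e3r _] _ [_ br _ _] _]]]]]]]]] :=
  Q4_coordinates r.
rewrite br => /(arrow_eq0 EY) k30; exists lc%:A.
by rewrite e3r k30 scale0r add0r mulr_algr.
Qed.

(** Only the coordinate of [t] at the vertex 3 survives multiplication by [c].
    This describes both the cocycles for [Ext^2] and the dual of the simple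
    module. *)
Lemma annihilator_of_c t : t * e3 = t -> t * c = 0 ->
  exists k l, t = k *: b + l *: d.
Proof.
have [k1 [k2 [k3 [k4 [la [lb [lc [ld [_ [_ te3] _ [_ _ tc _]]]]]]]]]] :=
  Q4_coordinates t.
rewrite te3 tc => tE /(arrow_eq0 EY) k30; exists lb, ld.
by rewrite -{1}tE k30 scale0r add0r.
Qed.

(** * The indecomposable module with dimension vector [1, 0, 1, 0] *)
Section Module1010.
Variable N : lmodType R^c.
Hypothesis N_indec : indecomposable N.
Hypotheses (N1 : dim_at N e1 1) (N2 : dim_at N e2 0).
Hypotheses (N3 : dim_at N e3 1) (N4 : dim_at N e4 0).

Lemma vertex_sum4 : e1 + e2 + e3 + e4 = 1.
Proof.
rewrite -(vertex_sum EY) !big_ord_recl big_ord0 /= addr0 !addrA.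
by congr (_ + _ + _ + _); congr E; apply: val_inj.
Qed.

(** The module is [e1 R / a R], with generator [n1] at the vertex 1. The arrow
    [d] acts from the part at vertex 1 to the part at vertex 3 by a scalar
    [lam]; indecomposability forces it to be nonzero, so [n1] also generates
    the part at vertex 3. *)
Lemma module1010_presentation : exists n : N,
  [/\ n ⋅ e1 = n, n ⋅ a = 0, forall m, exists r, m = n ⋅ r
    & forall r, n ⋅ r = 0 -> exists s, e1 * r = a * s].
Proof.
have [n1 [n1_neq0 n1e1 n1P]] := dim_at1 (vertexM EY v1) N1.
have [n3 [n3_neq0 n3e3 n3P]] := dim_at1 (vertexM EY v3) N3.
have e2_0 := dim_at0 N2; have e4_0 := dim_at0 N4.
have mE (m : N) : m = m ⋅ e1 + m ⋅ e3.
  by rewrite -{1}[m]ract1 -vertex_sum4 !ractDr e2_0 e4_0 !addr0.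
have ma (m : N) : m ⋅ a = 0 by rewrite -ae2 ractM e2_0.
have mc (m : N) : m ⋅ c = 0 by rewrite -ce4 ractM e4_0.
have [lam n1d] := n3P (n1 ⋅ d); rewrite -ractM de3 in n1d.
have lam_neq0 : lam != 0.
  apply/eqP => lam0; rewrite lam0 scale0r ract0 in n1d.
  (* If [d] acts as zero, the parts at the vertices 1 and 3 are submodules with
     direct sum [N]. *)
  pose U : {pred N} := [pred m | m ⋅ e1 == m].
  pose V : {pred N} := [pred m | m ⋅ e3 == m].
  have U_sub : submod_closed U.
    split=> [|r u v]; rewrite !inE ?ract0l // => /eqP uU /eqP vU.
    rewrite -[r *: u]/(u ⋅ (r : R)) ractDl vU.
    have [k1 [k2 [k3 [k4 [la [lb [lc [ld [[e1r _ _ _] _ _ _]]]]]]]]] :=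
      Q4_coordinates (r : R).
    have [l uE] := n1P u.
    have ud : u ⋅ d = 0 by rewrite -uU uE -ractM mulr_algl (ractZ _ _ d) n1d ract0l.
    have -> : u ⋅ (r : R) = u ⋅ k1%:A.
      rewrite -{1}uU -ractM e1r !ractDr (ractZ _ _ e1) (ractZ _ _ a).
      by rewrite (ractZ _ _ d) ma ud !ract0l !addr0 uU.
    by rewrite -ractM mulr_algl (ractZ _ _ e1) uU.
  have V_sub : submod_closed V.
    split=> [|r u v]; rewrite !inE ?ract0l // => /eqP uV /eqP vV.
    rewrite -[r *: u]/(u ⋅ (r : R)) ractDl vV.
    have [k1 [k2 [k3 [k4 [la [lb [lc [ld [[_ _ e3r _] _ _ _]]]]]]]]] :=
      Q4_coordinates (r : R).
    have -> : u ⋅ (r : R) = u ⋅ k3%:A.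
      rewrite -{1}uV -ractM e3r !ractDr (ractZ _ _ e3) (ractZ _ _ c).
      by rewrite mc !ract0l !addr0 uV.
    by rewrite -ractM mulr_algl (ractZ _ _ e3) uV.
  have [_ /(_ U V U_sub V_sub)[m|m||]] := N_indec.
  - exists (m ⋅ e1), (m ⋅ e3); split; last exact: mE.
      by rewrite inE -ractM (vertexM EY).
    by rewrite inE -ractM (vertexM EY).
  - by rewrite !inE => /eqP <- /eqP; rewrite -ractM e13 ract0.
  - by move=> /(_ n1); rewrite inE n1e1 eqxx => /(_ isT)/eqP; rewrite (negPf n1_neq0).
  by move=> /(_ n3); rewrite inE n3e3 eqxx => /(_ isT)/eqP; rewrite (negPf n3_neq0).
exists n1; split=> // [m|r n1r].
  have [k1 mk1] := n1P m; have [k3 mk3] := n3P m.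
  exists (k1%:A + (lam^-1 * k3) *: d).
  rewrite ractDr (ractZ _ _ d) n1d -(ractM _ lam%:A) mulr_algl scalerA mulrA mulfV //.
  by rewrite mul1r -mk1 -mk3 -mE.
have [k1 [k2 [k3 [k4 [la [lb [lc [ld [[e1r _ _ _] _ _ _]]]]]]]]] :=
  Q4_coordinates r.
have n1e1r : n1 ⋅ (e1 * r) = 0 by rewrite ractM n1e1.
have k10 : k1 = 0.
  apply: (ract_alg_eq0 n1_neq0).
  have := congr1 (fun m => m ⋅ e1) n1e1r; rewrite /= ract0l e1r -ractM !mulrDl.
  rewrite -!scalerAl (vertexM EY) -[a * e1]mulr1 -ae2 -de3 -!mulrA.
  rewrite !mulr1 e31 (vertexM0 EY) // !mulr0 !scaler0 !addr0.
  by rewrite (ractZ _ _ e1) n1e1.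
have ld0 : ld = 0.
  have := n1e1r; rewrite e1r k10 scale0r add0r ractDr.
  rewrite (ractZ _ _ a) (ractZ _ _ d) ma ract0l add0r.
  rewrite n1d -ractM mulr_algl scalerA => /(ract_alg_eq0 n3_neq0)/eqP.
  by rewrite mulf_eq0 (negPf lam_neq0) => /eqP.
by exists la%:A; rewrite e1r k10 ld0 !scale0r add0r addr0 mulr_algr.
Qed.

(** The class of [d] generates a copy of [R e1]: [e1 * d = d], the class of [b]
    vanishes, and no nonzero multiple of [d] is a left multiple of [b], as [d]
    and [b] start at different vertices. *)
Lemma Ext2_module1010 :
  (exists x : 'Ext^2(N, right_regular R), x != 0) /\
  projective 'Ext^2(N, right_regular R).
Proof.
have [n [ne1 na n_gen n_ann]] := module1010_presentation.
have [phi [phi_lin phi_surj phi_ker]] := Ext2_cyclic_resolution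
  (vertexM EY v1) (vertexM EY v2) (vertexM EY v3) ne1 ae2 be3 e1a e2b na
  (arrowM EY v1 v2) (arrowM EY v2 v3) n_gen n_ann a_exact b_exact.
have b_adm : b * e3 = b /\ b * c = 0 by split; rewrite // (arrowM EY).
have d_adm : d * e3 = d /\ d * c = 0 by split; rewrite // (arrowM EY).
have O_adm : 0 * e3 = 0 /\ 0 * c = 0 by rewrite !mul0r.
have phib : phi b = 0 by apply/(phi_ker _ b_adm); exists 1; rewrite mul1r.
have phi0 : phi 0 = 0 by apply/(phi_ker _ O_adm); exists 0; rewrite mul0r.
have phiZ r : phi (r * d) = r *: phi d.
  by have := phi_lin r d 0 d_adm O_adm; rewrite phi0 !addr0.
have ann r : r *: phi d = 0 -> r * e1 = 0.
  have [k1 [k2 [k3 [k4 [la [lb [lc [ld [_ [re1 _] _ [_ _ rc rd]]]]]]]]]] :=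
    Q4_coordinates r.
  have rd_adm : (r * d) * e3 = r * d /\ (r * d) * c = 0.
    by rewrite -!mulrA de3 (arrowM EY) mulr0.
  rewrite -phiZ => /(phi_ker _ rd_adm)[s rdE].
  have : e1 * (r * d) = 0.
    have [? [k [? [? [? [? [? [? [_ _ _ [_ sb _ _]]]]]]]]]] := Q4_coordinates s.
    by rewrite rdE sb -scalerAr -e2b mulrA (vertexM0 EY) // mul0r scaler0.
  by rewrite rd -scalerAr e1d re1 => /(arrow_eq0 EY)->; rewrite scale0r.
split.
  exists (phi d); apply/eqP => phid.
  have := ann 1; rewrite phid scaler0 mul1r => /(_ erefl) e10.
  by have := arrow_neq0 EY v1; rewrite -e1a e10 mul0r eqxx.
apply: (idempotent_cyclic_projective (xi := phi d) (e := e1)) => //.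
  by rewrite -phiZ e1d.
move=> x; have [t [t_adm ->]] := phi_surj x; have [te3 tc] := t_adm.
have [k [l ->]] := annihilator_of_c te3 tc; exists l%:A.
have ld_adm : (l *: d) * e3 = l *: d /\ (l *: d) * c = 0.
  by rewrite -!scalerAl de3 (arrowM EY) scaler0.
rewrite -(mulr_algl k b) phi_lin // phib scaler0 add0r.
by rewrite -phiZ mulr_algl.
Qed.

End Module1010.

(** * The simple module at the vertex 3 *)
Section Simple3.
Variable S : lmodType R^c.
Hypothesis S_simple : simple_module S.
Hypothesis S_at3 : exists m : S, m ⋅ e3 != 0.

(** Simplicity is used twice: [m0 ⋅ c] lies in the submodule of elements fixed
    by [e4], which does not contain [m0]; and the line spanned by [m0] is then a
    submodule. *)
Lemma simple3_generator : exists m0 : S,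
  [/\ m0 != 0, m0 ⋅ e3 = m0, m0 ⋅ c = 0 & forall m, exists k : K, m = m0 ⋅ k%:A].
Proof.
have [m me3] := S_at3; set m0 := m ⋅ e3 in me3.
have m0e3 : m0 ⋅ e3 = m0 by rewrite -ractM (vertexM EY).
have m0c : m0 ⋅ c = 0.
  pose U : {pred S} := [pred u | u ⋅ e4 == u].
  have U_sub : submod_closed U.
    split=> [|r u v]; rewrite !inE ?ract0l // => /eqP uU /eqP vU.
    rewrite -[r *: u]/(u ⋅ (r : R)) ractDl vU.
    have [k1 [k2 [k3 [k4 [la [lb [lc [ld [[_ _ _ e4r] _ _ _]]]]]]]]] :=
      Q4_coordinates (r : R).
    have -> : u ⋅ (r : R) = u ⋅ k4%:A.
      by rewrite -{1}uU -ractM e4r (ractZ _ _ e4) uU.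
    by rewrite -ractM mulr_algl (ractZ _ _ e4) uU.
  have [_ /(_ U U_sub)[U0|UT]] := S_simple.
    by apply: U0; rewrite inE -ractM ce4.
  have := UT m0; rewrite inE -m0e3 -ractM e34 ract0 eq_sym.
  by rewrite m0e3 (negPf me3).
exists m0; split=> //.
pose U : {pred S} := fun u => `[< exists k : K, u = m0 ⋅ k%:A >].
have U_sub : submod_closed U.
  split=> [|r u v]; first by apply/asboolP; exists 0; rewrite scale0r ract0.
  move=> /asboolP[k ->] /asboolP[l ->]; apply/asboolP.
  have [k1 [k2 [k3 [k4 [la [lb [lc [ld [[_ _ e3r _] _ _ _]]]]]]]]] :=
    Q4_coordinates (r : R).
  exists (k3 * k + l); rewrite ract_algD; congr (_ + _).
  rewrite -[LHS]/(m0 ⋅ k%:A ⋅ (r : R)) -ractM mulr_algl (ractZ _ _ (r : R)).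
  rewrite -{1}m0e3 -(ractM _ e3) e3r ractDr (ractZ _ _ e3) (ractZ _ _ c).
  by rewrite m0c ract0l addr0 m0e3 -ractM mulr_algl scalerA.
have [_ /(_ U U_sub)[U0|UT]] := S_simple.
  have m0U : m0 \in U by apply/asboolP; exists 1; rewrite scale1r ract1.
  by have /eqP := U0 m0 m0U; rewrite (negPf me3).
by move=> u; exact/asboolP/UT.
Qed.

Section Bidual.
Variable m0 : S.
Hypotheses (m0_neq0 : m0 != 0) (m0e3 : m0 ⋅ e3 = m0) (m0c : m0 ⋅ c = 0).
Hypothesis m0_gen : forall m, exists k : K, m = m0 ⋅ k%:A.

(** [b] and [d] span right submodules of [R] isomorphic to the simple module. *)
Lemma simple3_character r : exists k : K,
  [/\ m0 ⋅ r = m0 ⋅ k%:A, b * r = k *: b & d * r = k *: d].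
Proof.
have [k1 [k2 [k [k4 [la [lb [lc [ld [[_ _ e3r _] _ [_ br _ dr] _]]]]]]]]] :=
  Q4_coordinates r.
exists k; split=> //.
rewrite -{1}m0e3 -ractM e3r ractDr (ractZ _ _ e3) (ractZ _ _ c).
by rewrite m0c ract0l addr0 m0e3.
Qed.

Lemma simple3_dual_element t :
    (forall r k, m0 ⋅ r = m0 ⋅ k%:A -> t * r = k *: t) ->
  exists f : rdual S, f m0 = t.
Proof.
move=> tP; have [kappa kappaE] := choice m0_gen.
have kappa_uniq k m : m = m0 ⋅ k%:A -> kappa m = k.
  move=> mE; apply/eqP; rewrite -subr_eq0; apply/eqP/(ract_alg_eq0 m0_neq0).
  by rewrite scalerBl ractBr -kappaE -mE subrr.
have fP : (fun m => kappa m *: t) \in @hom_pred R^c R S (right_regular R).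
  apply/asboolP => r m n; have [k [rk _ _]] := simple3_character (r : R).
  have -> : kappa (r *: m + n) = k * kappa m + kappa n.
    apply: kappa_uniq; rewrite ract_algD -kappaE; congr (_ + n).
    rewrite -[LHS]/(m ⋅ (r : R)) {1}(kappaE m) -ractM mulr_algl.
    by rewrite (ractZ _ _ (r : R)) rk -ractM mulr_algl scalerA.
  rewrite -[RHS]/((kappa m *: t) * (r : R) + kappa n *: t).
  by rewrite -scalerAl (tP _ _ rk) scalerA scalerDl mulrC.
exists (Hom fP); rewrite -[LHS]/(kappa m0 *: t) (kappa_uniq 1) ?scale1r //.
by rewrite ract1.
Qed.

Variables fb fd : rdual S.
Hypotheses (fb_m0 : fb m0 = b) (fd_m0 : fd m0 = d).

Lemma rdual_eq (f g : rdual S) : f m0 = g m0 -> f = g.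
Proof.
move=> fg; apply: hom_ext => m; have [k ->] := m0_gen m.
by rewrite !rdual_act fg.
Qed.

(** The last equation extracts the coordinate along [fd], because [b] and [d]
    start at different vertices. *)
Lemma rdual_span f : exists k l : K,
  [/\ f = k%:A *: fb + l%:A *: fd, f m0 = k *: b + l *: d & e1 * f m0 = l *: d].
Proof.
have [k [l fE]] : exists k l, f m0 = k *: b + l *: d.
  apply: annihilator_of_c; first by have := rdual_act f m0 e3; rewrite m0e3.
  by have := rdual_act f m0 c; rewrite m0c hom0.
exists k, l; split=> //.
  by apply: rdual_eq; rewrite rdualD !rdualZ fb_m0 fd_m0 !mulr_algl.
by rewrite fE mulrDr -!scalerAr e1b e1d scaler0 add0r.
Qed.

Lemma bidual_eq (F G : ldual (rdual S)) : F fb = G fb -> F fd = G fd -> F = G.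
Proof.
move=> Fb Fd; apply: hom_ext => f; have [k [l [-> _ _]]] := rdual_span f.
by rewrite !bidualD !bidualZ Fb Fd.
Qed.

(** [F fb] lies in [e2 R] and is killed by [a], since [a *: fb = 0]; exactness
    at [e2 R] then makes it a multiple of [b]. *)
Lemma bidual_fb (F : ldual (rdual S)) : exists k : K, F fb = k *: b.
Proof.
have e2fb : e2 *: fb = fb by apply: rdual_eq; rewrite rdualZ fb_m0.
have afb : a *: fb = 0.
  by apply: rdual_eq; rewrite rdualZ fb_m0 (arrowM EY).
have [s sE] : exists s, e2 * (F fb : R) = b * s.
  by apply: a_exact; rewrite -bidualZ afb bidual0.
have [k [_ bs _]] := simple3_character s.
by exists k; rewrite -bs -sE -bidualZ e2fb.
Qed.

Lemma bidual_fd (F : ldual (rdual S)) : e1 * (F fd : R) = F fd.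
Proof. by rewrite -bidualZ; congr (F _); apply: rdual_eq; rewrite rdualZ fd_m0. Qed.

(** The generator of the summand [e1 R] of the bidual. *)
Lemma bidual_e1_element : exists T : ldual (rdual S),
  T fb = 0 /\ T fd = e1.
Proof.
have /choice[coef coefE] : forall f : rdual S, exists l : K, e1 * f m0 = l *: d.
  by move=> f; have [k [l [_ _ fE]]] := rdual_span f; exists l.
have coef_uniq l (f : rdual S) : e1 * f m0 = l *: d -> coef f = l.
  move=> fE; apply/eqP; rewrite -subr_eq0; apply/eqP/(arrow_eq0 EY (x := v4)).
  by rewrite scalerBl -coefE fE subrr.
have TP : (fun f : rdual S => coef f *: e1)
    \in @hom_pred R R^c (rdual S) (left_regular R).
  apply/asboolP => r f g.
  have [k1 [k2 [k3 [k4 [la [lb [lc [ld [_ [re1 _] _ [_ rb _ rd]]]]]]]]]] :=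
    Q4_coordinates r.
  have -> : coef (r *: f + g) = coef f * k1 + coef g.
    apply: (coef_uniq); rewrite rdualD rdualZ mulrDr coefE scalerDl; congr (_ + _).
    have [k [l [_ fE fE1]]] := rdual_span f; rewrite (coef_uniq _ _ fE1) fE.
    rewrite !mulrDr -!scalerAr rb rd -!scalerAr e1b e1d !scaler0 add0r.
    by rewrite scalerA.
  rewrite -[RHS]/(r * (coef f *: e1) + coef g *: e1).
  by rewrite -scalerAr re1 scalerA scalerDl.
exists (Hom TP); split.
  rewrite -[LHS]/(coef fb *: e1) (coef_uniq 0) ?scale0r //.
  by rewrite fb_m0 e1b.
rewrite -[LHS]/(coef fd *: e1) (coef_uniq 1) ?scale1r //.
by rewrite fd_m0 e1d.
Qed.

(** The projection of the bidual onto its other summand, which identifies [K b]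
    with the simple module. *)
Lemma bidual_retraction : exists phi : {linear ldual (rdual S) -> S},
  forall (F : ldual (rdual S)) k, F fb = k *: b -> phi F = m0 ⋅ k%:A.
Proof.
have [coef coefE] := choice bidual_fb.
have coef_uniq k (F : ldual (rdual S)) : F fb = k *: b -> coef F = k.
  move=> FE; apply/eqP; rewrite -subr_eq0; apply/eqP/(arrow_eq0 EY (x := v2)).
  by rewrite scalerBl -coefE FE subrr.
pose phi (F : ldual (rdual S)) := m0 ⋅ (coef F)%:A.
have phi_lin : linear phi.
  move=> r F G; have [k [rk br _]] := simple3_character (r : R).
  have -> : phi (r *: F + G) = m0 ⋅ (k * coef F + coef G)%:A.
    congr (_ ⋅ _%:A); apply: coef_uniq.
    rewrite bidual_add -[(r *: F) fb]/((F fb : R) * (r : R)) !coefE.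
    by rewrite -scalerAl br scalerA scalerDl mulrC.
  rewrite ract_algD; congr (_ + _).
  rewrite -[RHS]/(m0 ⋅ (coef F)%:A ⋅ (r : R)) -ractM mulr_algl.
  by rewrite (ractZ _ _ (r : R)) rk -ractM mulr_algl scalerA.
pose Phi : {linear ldual (rdual S) -> S} :=
  HB.pack phi (GRing.isLinear.Build R^c (ldual (rdual S)) S *:%R phi phi_lin).
by exists Phi => F k /coef_uniq kE; rewrite -[LHS]/(m0 ⋅ (coef F)%:A) kE.
Qed.

Lemma bidual_two_reflexive_not_reflexive : two_reflexive S /\ ~ reflexive_module S.
Proof.
have [T [Tb Td]] := bidual_e1_element.
have [phi phiE] := bidual_retraction.
have ev_fb k : ev (m0 ⋅ k%:A) fb = k *: b.
  by rewrite -[LHS]/(fb _) rdual_act fb_m0 mulr_algr.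
have phi_ev m : phi (ev m) = m.
  by have [k ->] := m0_gen m; exact: phiE.
split; last first.
  (* [T] is not in the image of [ev]: vanishing at [fb] forces its preimage to
     be zero. *)
  move=> [g _ gK].
  have := gK T; have [k ->] := m0_gen (g T) => evT.
  have k0 : k = 0 by apply: (arrow_eq0 EY (x := v2)); rewrite -ev_fb evT.
  have := e1d; rewrite -Td -evT k0 scale0r ract0 -[ev 0 fd]/(fd 0) hom0 mul0r.
  by move/eqP; rewrite eq_sym (negPf (arrow_neq0 EY v4)).
move=> X _; exists (@Ext_map _ _ (ab_bimod X) 1 _ _ phi).
  move=> x; pose idm : {linear ldual (rdual S) -> ldual (rdual S)} := idfun.
  pose evphi : {linear ldual (rdual S) -> ldual (rdual S)} :=
    @ev R S \o phi.
  (* [ev \o phi] and the identity agree at [fb]; the difference of their values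
     at [fd] acts on [T], which gives a factorization through a free module. *)
  pose delta : {linear ldual (rdual S) -> ldual (rdual S)} := evphi \- idm.
  pose y : {linear ldual (rdual S) -> (R^c)^o} := bidual_eval fd \o delta.
  pose oT : {linear (R^c)^o -> res 0 (ldual (rdual S))} :=
    orbit_map (<< T >> : res 0 (ldual (rdual S))).
  pose t : {linear ldual (rdual S) -> res 0 (ldual (rdual S))} := oT \o y.
  have homotopy (F : ldual (rdual S)) :
      evphi F - idm F = free_aug (ldual (rdual S)) (t F).
    set G := evphi F - idm F.
    have -> : free_aug (ldual (rdual S)) (t F) = T ⋅ (G fd : R).
      rewrite -[t F]/(@ract R (res 0 (ldual (rdual S))) << T >> (G fd : R)).
      by rewrite linear_ract free_augU.
    apply: bidual_eq; last by rewrite bidual_act Td bidual_fd.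
    rewrite bidual_act Tb mul0r bidual_sub.
    have [k FE] := bidual_fb F.
    by rewrite -[evphi F]/(ev (phi F)) (phiE _ _ FE) ev_fb -FE subrr.
  apply: (etrans (esym (Ext_map_comp (h := evphi) (fun=> erefl) x))).
  apply: (etrans (Ext1_map_homotopy homotopy x)).
  exact: Ext_map_id.
move=> x; pose phiev : {linear S -> S} := phi \o @ev R S.
apply: (etrans (esym (Ext_map_comp (h := phiev) (fun=> erefl) x))).
by apply: (Ext_map_id (f := phiev)) => m; exact: phi_ev.
Qed.

End Bidual.

Lemma simple3_two_reflexive_not_reflexive : two_reflexive S /\ ~ reflexive_module S.
Proof.
have [m0 [m0_neq0 m0e3 m0c m0_gen]] := simple3_generator.
have char r k : m0 ⋅ r = m0 ⋅ k%:A -> b * r = k *: b /\ d * r = k *: d.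
  move=> rk; have [l [rl -> ->]] := simple3_character m0e3 m0c r.
  suff -> : k = l by [].
  apply/eqP; rewrite -subr_eq0; apply/eqP/(ract_alg_eq0 m0_neq0).
  by rewrite scalerBl ractBr -rk -rl subrr.
have [fb fbE] : exists f : rdual S, f m0 = b.
  by apply: simple3_dual_element => // r k /char[].
have [fd fdE] : exists f : rdual S, f m0 = d.
  by apply: simple3_dual_element => // r k /char[].
exact: bidual_two_reflexive_not_reflexive fbE fdE.
Qed.

End Simple3.
End Q4Modules.

(** The numbering of the vertices shows that the quiver is acyclic. *)
Lemma Q4_height (x : arrow Q4) : (source x < target x)%N.
Proof. by case: x => [[|[|[|[|]]]]]. Qed.

Theorem proposition0p2 (K : fieldType) (R : algType K)
    (pi : {lrmorphism path_algebra K Q4 -> R})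
    (R_def : is_rad_square_zero_algebra pi) :
  (forall N : lmodType R^c,
     indecomposable N ->
     has_dimension_vector pi N (tnth [tuple 1; 0; 1; 0]%N) ->
     (exists x : 'Ext^2(N, right_regular R), x != 0) /\
     projective 'Ext^2(N, right_regular R)) /\
  (forall S3 : lmodType R^c,
     is_simple_at pi S3 v3 ->
     two_reflexive S3 /\ ~ reflexive_module S3).
Proof.
have EY := rad_square_zero_basisP R_def Q4_height.
split=> [N N_indec N_dim|S [S_simple S_at3]].
  exact: (Ext2_module1010 EY N_indec (N_dim v1) (N_dim v2) (N_dim v3) (N_dim v4)).
exact: (simple3_two_reflexive_not_reflexive EY S_simple S_at3).
Qed.
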